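(* Let $\gamma=(\gamma_{ij}(x))$ be a Riemannian metric on $M$ and let $\alpha=\alpha(x,y)$ be a homogeneous polynomial function in $y$ of degree $m>0$ with the property $$\alpha_{;i}=0,\qquad i=1,\dots,n,$$ where the covariant derivative $;$ is taken with respect to the canonical connection arising from $\gamma$. Then the root metric space $(M,F)$ (of order $m+2$) with $$F^{m+2}=\bar T=\alpha(x,y)\,\gamma_{ij}(x)y^iy^j$$ is projective to the Riemannian space $(M,\gamma)$.
   Context: Let $M$ be a smooth $n$-dimensional manifold with induced coordinates $(x^i,y^i)$ on $TM$. A root metric space of order $k\ge 2$ is $(M,F)$ with $F=\sqrt[k]{a_{i_1\dots i_k}(x)y^{i_1}\cdots y^{i_k}}$, $a_{i_1\dots i_k}$ totally symmetric, such that $g_{ij}=\frac12\frac{\partial^2F^2}{\partial y^i\partial y^j}$ is nondegenerate on $TM\setminus\{0\}$ (at the points where $F$ is defined and smooth); it is part of the hypothesis that the $F$ of the statement defines such a space. For the Riemannian metric $\gamma$ with Christoffel symbols $\Gamma^i_{\ jk}(x)$ the canonical nonlinear connection is $N^i_{\ j}=\Gamma^i_{\ jk}y^k$, and $\alpha_{;i}=\frac{\partial\alpha}{\partial x^i}-N^r_{\ i}\frac{\partial\alpha}{\partial y^r}$. Two Finsler (or Riemannian) metrics on $M$ are projective if every geodesic of either one coincides, as a set of points, with a geodesic of the other.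
   Formalization: In ''projective'', a geodesic of γ is compared with those of F only if F is defined and smooth at one of its velocities at least; along the others (e.g. α = 0 along the curve) F has no geodesic and the literal claim fails, as for α = (y¹)³ − 3y¹(y²)² in the flat plane. *)

(* Defs.v *)
From HB Require Import structures.
From mathcomp Require Import all_boot all_order all_algebra all_fingroup.
From mathcomp Require Import all_classical all_reals all_analysis.

Set Implicit Arguments.
Unset Strict Implicit.
Unset Printing Implicit Defensive.

Import Order.TTheory GRing.Theory Num.Theory.
Import numFieldNormedType.Exports.

Local Open Scope classical_set_scope.
Local Open Scope ring_scope.

(* In finite dimension this is the usual class C^k on the open set U.         *)
Fixpoint Ck_on (R : realType) (V W : normedModType R) (k : nat)
    (U : set V) (f : V -> W) : Prop :=
  match k with
  | 0 => forall x, U x -> {for x, continuous f}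
  | k'.+1 => (forall x, U x -> differentiable f x) /\
             (forall v : V, Ck_on k' U (fun x => 'D_v f x))
  end.

Definition smooth_on (R : realType) (V W : normedModType R)
    (U : set V) (f : V -> W) : Prop :=
  forall k, Ck_on k U f.

(* [coord] and [param] are total; they are mutually inverse homeomorphisms    *)
(* between [cdom] and its open image, and arbitrary elsewhere.                *)
Record chart (R : realType) (n : nat) (M : topologicalType) := Chart {
  cdom : set M;
  coord : M -> 'rV[R]_n;
  param : 'rV[R]_n -> M;
  cdom_open : open cdom;
  cimg_open : open (coord @` cdom);
  coord_cont : forall p, cdom p -> {for p, continuous coord};
  param_cont : forall x, (coord @` cdom) x -> {for x, continuous param};
  coordK : forall p, cdom p -> param (coord p) = p
}.

Definition cimg (R : realType) (n : nat) (M : topologicalType)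
    (c : chart R n M) : set 'rV[R]_n :=
  coord c @` cdom c.

Definition transition (R : realType) (n : nat) (M : topologicalType)
    (c d : chart R n M) : 'rV[R]_n -> 'rV[R]_n :=
  fun x => coord d (param c x).

Record manifold (R : realType) (n : nat) := Manifold {
  points :> topologicalType;
  man_hausdorff : hausdorff_space points;
  man_countable : @second_countable points;
  atlas : Type;
  chart_of : atlas -> chart R n points;
  chart_cover : forall p, exists a, cdom (chart_of a) p;
  chart_compat : forall a b : atlas,
    smooth_on
      (coord (chart_of a) @` (cdom (chart_of a) `&` cdom (chart_of b)))
      (transition (chart_of a) (chart_of b))
}.

Definition basis_vec (R : realType) (n : nat) (i : 'I_n) : 'rV[R]_n :=
  delta_mx 0 i.
Arguments basis_vec : clear implicits.

(* Functions of the induced coordinates z = (x, y), and the partial           *)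
(* derivatives with respect to x^i and y^i.                                   *)
Definition dx (R : realType) (n : nat) (i : 'I_n)
    (f : 'rV[R]_n * 'rV[R]_n -> R) (z : 'rV[R]_n * 'rV[R]_n) : R :=
  'D_((basis_vec R n i, 0) : 'rV[R]_n * 'rV[R]_n) f z.

Definition dy (R : realType) (n : nat) (i : 'I_n)
    (f : 'rV[R]_n * 'rV[R]_n -> R) (z : 'rV[R]_n * 'rV[R]_n) : R :=
  'D_((0, basis_vec R n i) : 'rV[R]_n * 'rV[R]_n) f z.

(* TM is handled through the induced coordinates: a function on TM is the     *)
(* family of its expressions f a (x, y), one for each chart a; only the       *)
(* values at x in the image of the chart matter.                              *)
Definition tm_fun (R : realType) (n : nat) (M : manifold R n) : Type :=
  atlas M -> 'rV[R]_n * 'rV[R]_n -> R.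

(* 'D_y (transition a b) x has components (dx'^j / dx^i) y^i.                 *)
Definition tm_compatible (R : realType) (n : nat) (M : manifold R n)
    (f : tm_fun M) : Prop :=
  forall (a b : atlas M) (p : M) (y : 'rV[R]_n),
    cdom (chart_of a) p -> cdom (chart_of b) p ->
    f a (coord (chart_of a) p, y) =
    f b (coord (chart_of b) p,
         'D_y (transition (chart_of a) (chart_of b)) (coord (chart_of a) p)).

(* a_{i_1 ... i_k}(x) y^{i_1} ... y^{i_k}, with multi-indices                 *)
(* I = (i_1, ..., i_k) encoded as functions 'I_k -> 'I_n.                     *)
Definition form_eval (R : realType) (n k : nat)
    (a : {ffun 'I_k -> 'I_n} -> 'rV[R]_n -> R) (z : 'rV[R]_n * 'rV[R]_n) : R :=
  \sum_(I : {ffun 'I_k -> 'I_n}) a I z.1 * \prod_(j < k) z.2 0 (I j).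

Definition homogeneous_polynomial (R : realType) (n : nat) (M : manifold R n)
    (k : nat) (f : tm_fun M) : Prop :=
  tm_compatible f /\
  forall c : atlas M, exists a : {ffun 'I_k -> 'I_n} -> 'rV[R]_n -> R,
    (forall I, smooth_on (cimg (chart_of c)) (a I)) /\
    (forall x y, cimg (chart_of c) x -> f c (x, y) = form_eval a (x, y)).

Definition symmetric_form (R : realType) (n : nat) (M : manifold R n)
    (k : nat) (f : tm_fun M) : Prop :=
  tm_compatible f /\
  forall c : atlas M, exists a : {ffun 'I_k -> 'I_n} -> 'rV[R]_n -> R,
    [/\ forall I, smooth_on (cimg (chart_of c)) (a I),
        forall (s : {perm 'I_k}) (I : {ffun 'I_k -> 'I_n}) x,
          cimg (chart_of c) x -> a [ffun j => I (s j)] x = a I x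
      & forall x y, cimg (chart_of c) x -> f c (x, y) = form_eval a (x, y)].

Definition bilin (R : realType) (n : nat) (G : 'M[R]_n) (u v : 'rV[R]_n) : R :=
  \sum_(i < n) \sum_(j < n) G i j * u 0 i * v 0 j.

Record riemannian (R : realType) (n : nat) (M : manifold R n) := Riemannian {
  rmx : atlas M -> 'rV[R]_n -> 'M[R]_n;
  rmx_smooth : forall a i j,
    smooth_on (cimg (chart_of a)) (fun x => rmx a x i j);
  rmx_sym : forall a x i j, cimg (chart_of a) x -> rmx a x i j = rmx a x j i;
  rmx_pos : forall a x y, cimg (chart_of a) x -> y != 0 ->
    0 < bilin (rmx a x) y y;
  rmx_tensor : forall (a b : atlas M) (p : M) (u v : 'rV[R]_n),
    cdom (chart_of a) p -> cdom (chart_of b) p ->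
    bilin (rmx a (coord (chart_of a) p)) u v =
    bilin (rmx b (coord (chart_of b) p))
      ('D_u (transition (chart_of a) (chart_of b)) (coord (chart_of a) p))
      ('D_v (transition (chart_of a) (chart_of b)) (coord (chart_of a) p))
}.

Definition rquad (R : realType) (n : nat) (M : manifold R n)
    (gamma : riemannian M) : tm_fun M :=
  fun a z => bilin (rmx gamma a z.1) z.2 z.2.

Definition christoffel (R : realType) (n : nat) (M : manifold R n)
    (gamma : riemannian M) (a : atlas M) (x : 'rV[R]_n) (i j k : 'I_n) : R :=
  2^-1 * \sum_(l < n) invmx (rmx gamma a x) i l *
    ('D_(basis_vec R n j) (fun x' => rmx gamma a x' l k) x
     + 'D_(basis_vec R n k) (fun x' => rmx gamma a x' j l) x
     - 'D_(basis_vec R n l) (fun x' => rmx gamma a x' j k) x).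

Definition nonlinear_connection (R : realType) (n : nat) (M : manifold R n)
    (gamma : riemannian M) (a : atlas M) (z : 'rV[R]_n * 'rV[R]_n)
    (i j : 'I_n) : R :=
  \sum_(k < n) christoffel gamma a z.1 i j k * z.2 0 k.

Definition covariant_derivative (R : realType) (n : nat) (M : manifold R n)
    (gamma : riemannian M) (f : tm_fun M) (a : atlas M)
    (z : 'rV[R]_n * 'rV[R]_n) (i : 'I_n) : R :=
  dx i (f a) z
  - \sum_(r < n) nonlinear_connection gamma a z r i * dy r (f a) z.

(* A possibly partially defined fundamental function on TM: [fdef] is where   *)
(* it is defined.                                                             *)
Record fundamental (R : realType) (n : nat) (M : manifold R n) := Fundamental {
  fdef : atlas M -> set ('rV[R]_n * 'rV[R]_n);
  fval : tm_fun M
}.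

Definition regular (R : realType) (n : nat) (M : manifold R n)
    (F : fundamental M) (a : atlas M) : set ('rV[R]_n * 'rV[R]_n) :=
  [set z | [/\ cimg (chart_of a) z.1, z.2 != 0 &
     exists W : set ('rV[R]_n * 'rV[R]_n),
       [/\ open W, W z, W `<=` fdef F a & smooth_on W (fval F a)]]].

Definition fsquare (R : realType) (n : nat) (M : manifold R n)
    (F : fundamental M) : tm_fun M :=
  fun a z => fval F a z ^+ 2.

Definition fundamental_tensor (R : realType) (n : nat) (M : manifold R n)
    (F : fundamental M) (a : atlas M) (z : 'rV[R]_n * 'rV[R]_n) : 'M[R]_n :=
  \matrix_(i < n, j < n) (2^-1 * dy i (dy j (fsquare F a)) z).

(* The real k-th root, taken to be defined at t when k is odd or 0 <= t.      *)
Definition real_root (R : realType) (k : nat) (t : R) : R :=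
  Num.sg t * (`|t| `^ (k%:R^-1)).

Definition root_fundamental (R : realType) (n : nat) (M : manifold R n)
    (k : nat) (T : tm_fun M) : fundamental M :=
  Fundamental (fun a => [set z | odd k \/ 0 <= T a z])
              (fun a z => real_root k (T a z)).

Definition root_metric_space (R : realType) (n : nat) (M : manifold R n)
    (k : nat) (T : tm_fun M) : Prop :=
  [/\ (2 <= k)%N,
      symmetric_form k T
    & forall (a : atlas M) (z : 'rV[R]_n * 'rV[R]_n),
        regular (root_fundamental k T) a z ->
        \det (fundamental_tensor (root_fundamental k T) a z) != 0].

Definition riemannian_fundamental (R : realType) (n : nat) (M : manifold R n)
    (gamma : riemannian M) : fundamental M :=
  Fundamental (fun a => setT) (fun a z => Num.sqrt (rquad gamma a z)).

Definition curve_lift (R : realType) (n : nat) (M : manifold R n)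
    (c : R -> M) (a : atlas M) (t : R) : 'rV[R]_n * 'rV[R]_n :=
  (coord (chart_of a) (c t), derive1 (fun s => coord (chart_of a) (c s)) t).

(* Geodesics are affinely parametrized, i.e. solutions of the Euler-Lagrange  *)
(* equations of F^2, on nonempty open intervals, with velocities at which F   *)
(* is defined and smooth (in particular nonzero velocities).                  *)
Definition is_geodesic (R : realType) (n : nat) (M : manifold R n)
    (F : fundamental M) (J : set R) (c : R -> M) : Prop :=
  [/\ [/\ open J, is_interval J & J !=set0],
      forall t, J t -> {for t, continuous c},
      forall a : atlas M,
        smooth_on [set t | J t /\ cdom (chart_of a) (c t)]
                  (fun t => coord (chart_of a) (c t))
    & forall (a : atlas M) t, J t -> cdom (chart_of a) (c t) ->
        regular F a (curve_lift c a t) /\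
        forall i : 'I_n,
          is_derive t (1 : R) (fun s => dy i (fsquare F a) (curve_lift c a s))
            (dx i (fsquare F a) (curve_lift c a t))].

(* Curves with no velocity at which F2 is defined and smooth are not compared *)
(* with the geodesics of F2; a single such velocity is enough for a curve to  *)
(* be compared.                                                               *)
Definition geodesics_transfer (R : realType) (n : nat) (M : manifold R n)
    (F1 F2 : fundamental M) : Prop :=
  forall (J : set R) (c : R -> M), is_geodesic F1 J c ->
    (exists (a : atlas M) (t : R),
       [/\ J t, cdom (chart_of a) (c t) & regular F2 a (curve_lift c a t)]) ->
    exists (J' : set R) (c' : R -> M),
      is_geodesic F2 J' c' /\ c' @` J' = c @` J.

Definition projective (R : realType) (n : nat) (M : manifold R n)
    (F1 F2 : fundamental M) : Prop :=
  geodesics_transfer F1 F2 /\ geodesics_transfer F2 F1.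

(* Main.v *)
(** In induced coordinates put [L = F^2] and let [;] be the horizontal derivative
    of [gamma].  When [L_{;i} = 0], differentiating this identity along the
    fibre and commuting partial derivatives shows that the Euler-Lagrange
    expression of [L] along a curve [c] is its vertical Hessian applied to the
    covariant acceleration [c'' + Gamma(c', c')].  So whenever the Hessian is
    nondegenerate, the geodesics are exactly the curves with zero covariant
    acceleration.  Metricity gives [q_{;i} = 0] for [q = gamma_{ij} y^i y^j],
    hence [T = alpha q] and [F = T^(1/(m+2))] are horizontally constant too, and
    both metrics have the same affinely parametrized geodesics wherever they are
    both regular.

    The regular directions of [F] are those with [T <> 0] (and [T > 0] for
    even order).  Indeed, if [F] is differentiable at a zero of [T], then [T] is
    [O(s^(m+2))] on every line through that direction, hence so is [alpha], which
    has degree [m]; thus [alpha] vanishes on the fibre and the fundamental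
    tensor is degenerate.  As [T] is constant along the geodesics of [gamma], a
    geodesic regular for [F] at one time is regular at all times. *)
Require Import Defs.
From HB Require Import structures.
From mathcomp Require Import all_boot all_order all_algebra all_fingroup.
From mathcomp Require Import all_classical all_reals all_analysis.
From mathcomp Require Import ring zify.

Import Order.TTheory GRing.Theory Num.Theory.
Import numFieldNormedType.Exports.
Import Defs.

Local Open Scope classical_set_scope.
Local Open Scope ring_scope.

Set Implicit Arguments.
Unset Strict Implicit.

(** * Functions of class C^k *)

(** The first-order expansion of [f] at [x] only involves the germ, so it is also an expansion of
    [g]; uniqueness of the differential then identifies ['d g x] with ['d f x]. *)
Lemma near_eq_differentiable (R : realType) (V W : normedModType R)
    (f g : V -> W) (x : V) :
  (\forall y \near x, f y = g y) -> differentiable f x -> differentiable g x.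
Proof.
move=> fg df; have [dfc dfx] := (diff_locallyP _ _).1 df.
have E : g \o shift x = cst (g x) + 'd f x +o_ (0 : V) id.
  apply/eqaddoP => _/posnumP[e].
  have := (eqaddoP _ _ _ _).1 dfx e%:num [gt0 of e%:num].
  have fg0 : \forall h \near (0 : V), f (h + x) = g (h + x).
    move: fg; rewrite (near_shift 0) /=.
    by apply: filterS => h; rewrite /= subr0.
  apply: filter_app; near=> h.
  have fgh : f (h + x) = g (h + x) by near: h.
  rewrite -![(_ + _ : _ -> _) _]/(_ + _) -![(- _ : _ -> _) _]/(- _) /=.
  by rewrite -fgh -(nbhs_singleton fg).
by apply/diff_locallyP; rewrite (diff_unique dfc E).
Unshelve. all: by end_near. Qed.

(** Openness of [U] turns agreement on [U] into agreement near each point, which passes to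
    directional derivatives. The closure lemmas below use this to replace a derivative by its
    formula on [U]. *)
Lemma eq_Ck_on (R : realType) (V W : normedModType R) (k : nat) (U : set V)
    (f g : V -> W) :
  open U -> (forall x, U x -> f x = g x) -> Ck_on k U f -> Ck_on k U g.
Proof.
move=> oU; have nearU (h h' : V -> W) : (forall x, U x -> h x = h' x) ->
    forall x, U x -> \forall y \near x, h y = h' y.
  by move=> hh x Ux; apply: filterS hh _; exact: open_nbhs_nbhs.
elim: k f g => [|k IH] f g fg /=.
  move=> cf x Ux.
  have fx := nearU _ _ fg x Ux.
  suff : g @ x --> f x by rewrite fg.
  apply: cvg_trans (cf x Ux); apply: near_eq_cvg.
  by apply: filterS fx => y.
move=> [df Df]; split=> [x Ux|v].
  by apply: near_eq_differentiable (df x Ux); exact: nearU.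
apply: IH (Df v) => x Ux; apply: near_eq_derive; exact: nearU.
Qed.

Lemma Ck_onW (R : realType) (V W : normedModType R) (k : nat) (U : set V)
    (f : V -> W) : Ck_on k.+1 U f -> Ck_on k U f.
Proof.
elim: k f => [|k IH] f [df Df].
  by move=> x Ux; exact: differentiable_continuous (df x Ux).
by split=> // v; apply: IH; exact: Df.
Qed.

Lemma Ck_on_subset (R : realType) (V W : normedModType R) (k : nat)
    (U U' : set V) (f : V -> W) : U' `<=` U -> Ck_on k U f -> Ck_on k U' f.
Proof.
move=> sU; elim: k f => [|k IH] f.
  by move=> cf x Ux; exact: (cf x (sU x Ux)).
by move=> [df Df]; split=> [x /sU /df//|v]; exact: (IH _ (Df v)).
Qed.

Lemma Ck_on_cst (R : realType) (V W : normedModType R) (k : nat) (U : set V)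
    (w : W) : Ck_on k U (fun=> w : W).
Proof.
elim: k w => [|k IH] w; first by move=> x _; exact: cvg_cst.
split=> [x _|v]; first exact: differentiable_cst.
by under eq_fun do rewrite derive_cst; exact: IH.
Qed.

Lemma Ck_onD (R : realType) (V W : normedModType R) (k : nat) (U : set V)
    (f g : V -> W) : open U ->
  Ck_on k U f -> Ck_on k U g -> Ck_on k U (fun x => f x + g x).
Proof.
move=> oU; elim: k f g => [|k IH] f g.
  by move=> cf cg x Ux; apply: cvgD; [exact: (cf x Ux) | exact: (cg x Ux)].
move=> [df Df] [dg Dg]; split=> [x Ux|v].
  by apply: differentiableD; [exact: df | exact: dg].
apply: (eq_Ck_on oU _ (IH _ _ (Df v) (Dg v))) => x Ux.
by rewrite [RHS]deriveD //; apply: diff_derivable; [exact: df | exact: dg].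
Qed.

Lemma Ck_onM (R : realType) (V : normedModType R) (k : nat) (U : set V)
    (f g : V -> R) : open U ->
  Ck_on k U f -> Ck_on k U g -> Ck_on k U (fun x => f x * g x).
Proof.
move=> oU; elim: k f g => [|k IH] f g.
  by move=> cf cg x Ux; apply: cvgM; [exact: (cf x Ux) | exact: (cg x Ux)].
move=> Cf Cg; have [[df Df] [dg Dg]] := (Cf, Cg); split=> [x Ux|v].
  by apply: differentiableM; [exact: df | exact: dg].
have CC := Ck_onD oU (IH _ _ (Ck_onW Cf) (Dg v))
  (IH _ _ (Ck_onW Cg) (Df v)).
apply: (eq_Ck_on oU _ CC) => x Ux.
by rewrite [RHS]deriveM //; apply: diff_derivable; [exact: df | exact: dg].
Qed.

Lemma Ck_on_sum (R : realType) (V : normedModType R) (k : nat) (U : set V)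
    (I : Type) (r : seq I) (P : pred I) (f : I -> V -> R) : open U ->
  (forall i, P i -> Ck_on k U (f i)) ->
  Ck_on k U (fun x => \sum_(i <- r | P i) f i x).
Proof.
move=> oU Cf; elim: r => [|i r IH].
  by under eq_fun do rewrite big_nil; exact: Ck_on_cst.
under eq_fun do rewrite big_cons; case Pi: (P i) => //.
by apply: Ck_onD => //; exact: Cf.
Qed.

Lemma Ck_on_prod (R : realType) (V : normedModType R) (k : nat) (U : set V)
    (I : Type) (r : seq I) (P : pred I) (f : I -> V -> R) : open U ->
  (forall i, P i -> Ck_on k U (f i)) ->
  Ck_on k U (fun x => \prod_(i <- r | P i) f i x).
Proof.
move=> oU Cf; elim: r => [|i r IH].
  by under eq_fun do rewrite big_nil; exact: Ck_on_cst.
under eq_fun do rewrite big_cons; case Pi: (P i) => //.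
by apply: Ck_onM => //; exact: Cf.
Qed.

Lemma Ck_onV (R : realType) (V : normedModType R) (k : nat) (U : set V)
    (f : V -> R) : open U -> (forall x, U x -> f x != 0) ->
  Ck_on k U f -> Ck_on k U (fun x => (f x)^-1).
Proof.
move=> oU f0; elim: k => [|k IH].
  by move=> cf x Ux; apply: cvgV; [exact: f0 | exact: (cf x Ux)].
move=> Cf; have [df Df] := Cf; split=> [x Ux|v].
  by apply: differentiableV; [exact: df | exact: f0].
have CV := IH (Ck_onW Cf).
have C2 := Ck_onM oU (Ck_on_cst k U (- 1 : R))
  (Ck_onM oU (Ck_onM oU CV CV) (Df v)).
apply: (eq_Ck_on oU _ C2) => x Ux /=.
rewrite [RHS](@deriveV R V f); first by rewrite mulN1r -expr2 exprVn -scaleNr.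
  exact: f0.
by apply: diff_derivable; exact: df.
Qed.

Lemma derive_comp_linear (R : realType) (V V' W : normedModType R)
    (l : {linear V -> V'}) (g : V' -> W) (v z : V) : continuous l ->
  differentiable g (l z) -> 'D_v (fun z => g (l z)) z = 'D_(l v) g (l z).
Proof.
move=> cl dg; have dl : differentiable l z by exact: linear_differentiable.
by rewrite !deriveE ?(diff_comp dl dg)/= ?diff_lin//; exact: differentiable_comp.
Qed.

Lemma Ck_on_comp_linear (R : realType) (V V' W : normedModType R) (k : nat)
    (U : set V) (U' : set V') (l : {linear V -> V'}) (g : V' -> W) : open U ->
  continuous l -> (forall z, U z -> U' (l z)) ->
  Ck_on k U' g -> Ck_on k U (fun z => g (l z)).
Proof.
move=> oU cl lU; elim: k g => [|k IH] g.
  move=> cg z Uz; apply: continuous_comp; first exact: cl.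
  exact: (cg _ (lU _ Uz)).
move=> [dg Dg]; split=> [z Uz|v].
  apply: differentiable_comp; first exact: linear_differentiable.
  by apply: dg; exact: lU.
apply: (eq_Ck_on oU _ (IH _ (Dg (l v)))) => z Uz.
by rewrite derive_comp_linear //; apply: dg; exact: lU.
Qed.

Lemma is_derive_curve (R : realType) (V W : normedModType R) (l : R -> V)
    (f : V -> W) (t : R) : differentiable l t -> differentiable f (l t) ->
  is_derive t (1 : R) (fun s => f (l s)) ('D_('D_1 l t) f (l t)).
Proof.
move=> dl df; have dfl := differentiable_comp dl df.
apply: DeriveDef; first exact: diff_derivable.
by rewrite !deriveE// (diff_comp dl df).
Qed.

Lemma is_derive_line (R : realType) (V W : normedModType R) (x u : V)
    (f : V -> W) (t : R) : differentiable f (x + t *: u) ->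
  is_derive t (1 : R) (fun s => f (x + s *: u)) ('D_u f (x + t *: u)).
Proof.
move=> df.
have iZ : is_diff t ( *:%R^~ u : R -> V) ( *:%R^~ u) by exact: is_diff_scalel.
have dZ : differentiable ( *:%R^~ u : R -> V) t by exact: ex_diff.
have dl : differentiable (fun s : R => x + s *: u) t.
  by apply: differentiableD => //; exact: differentiable_cst.
have Dl : 'D_1 (fun s : R => x + s *: u) t = u.
  rewrite [LHS](@deriveD R R V (cst x) ( *:%R^~ u)) ?derive_cst ?add0r.
  - by rewrite deriveE// diff_val scale1r.
  - exact: derivable_cst.
  - exact: diff_derivable.
have := is_derive_curve dl df.
by rewrite Dl.
Qed.

(** * Symmetry of second derivatives *)

(** The mean value theorem is applied twice: along [u] to the [v]-increment [phi] of [f], then along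
    [v] to ['D_u f]. The second difference on the left is symmetric in [u] and [v], the right side
    is not; [derive_comm] exploits this. *)
Lemma second_difference_mvt (R : realType) (V : normedModType R) (U : set V)
    (f : V -> R) (x u v : V) (s : R) : Ck_on 2 U f -> 0 < s ->
  (forall a b, 0 <= a <= s -> 0 <= b <= s -> U (x + a *: u + b *: v)) ->
  exists a b, [/\ 0 <= a <= s, 0 <= b <= s &
    f (x + s *: u + s *: v) - f (x + s *: u) - f (x + s *: v) + f x
    = 'D_v ('D_u f) (x + a *: u + b *: v) * s ^+ 2].
Proof.
move=> [df Df] s0 Us; have [dDf _] := Df u.
have s00 : 0 <= s <= s by rewrite lexx ltW.
have s01 : (0 : R) <= 0 <= s by rewrite lexx ltW.
have Us0 a : 0 <= a <= s -> U (x + a *: u).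
  by move=> as_; have := Us a 0 as_ s01; rewrite scale0r addr0.
pose phi a := f (x + s *: v + a *: u) - f (x + a *: u).
have Dphi a : 0 <= a <= s -> is_derive a (1 : R) phi
    ('D_u f (x + s *: v + a *: u) - 'D_u f (x + a *: u)).
  move=> as_; apply: is_deriveB; apply: is_derive_line; apply: df.
    by rewrite addrAC; exact: Us.
  exact: Us0.
have [a + ea] : exists2 a, a \in `[0, s]%R & phi s - phi 0 =
    ('D_u f (x + s *: v + a *: u) - 'D_u f (x + a *: u)) * (s - 0).
  apply: (MVT_segment (ltW s0)) => [a|].
    by rewrite in_itv /= => /andP[/ltW a0 /ltW a1]; apply: Dphi; rewrite a0.
  apply: derivable_within_continuous => a; rewrite in_itv /= => as_.
  by have [] := Dphi a as_.
rewrite in_itv /= => as_.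
pose psi b := 'D_u f (x + a *: u + b *: v).
have Dpsi b : 0 <= b <= s -> is_derive b (1 : R) psi
    ('D_v ('D_u f) (x + a *: u + b *: v)).
  by move=> bs; apply: is_derive_line; apply: dDf; exact: Us.
have [b + eb] : exists2 b, b \in `[0, s]%R & psi s - psi 0 =
    'D_v ('D_u f) (x + a *: u + b *: v) * (s - 0).
  apply: (MVT_segment (ltW s0)) => [b|].
    by rewrite in_itv /= => /andP[/ltW a0 /ltW a1]; apply: Dpsi; rewrite a0.
  apply: derivable_within_continuous => b; rewrite in_itv /= => bs.
  by have [] := Dpsi b bs.
rewrite in_itv /= => bs; exists a, b; split=> //.
have -> : f (x + s *: u + s *: v) - f (x + s *: u) - f (x + s *: v) + f x
    = phi s - phi 0.
  rewrite /phi !scale0r !addr0 opprB [x + s *: v + _]addrAC !addrA.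
  by rewrite addrAC.
move: ea eb; rewrite /psi scale0r addr0 !subr0 [x + a *: u + _]addrAC => -> ->.
by rewrite expr2 mulrA.
Qed.

(** Computed in both orders, the same second difference gives equal values of the two mixed
    derivatives at two points close to [x]; continuity of both at [x] bounds their difference there
    by any [e > 0]. *)
Lemma derive_comm (R : realType) (V : normedModType R) (U : set V)
    (f : V -> R) (x u v : V) : open U -> U x -> Ck_on 2 U f ->
  'D_u ('D_v f) x = 'D_v ('D_u f) x.
Proof.
move=> oU Ux Cf; have [_ Df] := Cf.
have cont w1 w2 : {for x, continuous ('D_w2 ('D_w1 f))}.
  by have [_ /(_ w2)] := Df w1; exact.
have near_square (P : set V) : nbhs x P -> exists2 e : R, 0 < e &
    forall s : R, 0 < s < e -> forall a b : R, 0 <= a <= s -> 0 <= b <= s ->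
    P (x + a *: u + b *: v).
  move=> /nbhs_ballP[r /= r0 Pr].
  (* For [a] and [b] in [[0, s]] the displacement [a u + b v] has norm at most [s N]; the summand 1
     keeps [N] positive when [u] and [v] both vanish. *)
  pose N := `|u| + `|v| + 1.
  have N0 : 0 < N by rewrite ltr_wpDl// addr_ge0.
  exists (r / N); first by rewrite divr_gt0.
  move=> s /andP[s0 sr] a b /andP[a0 as_] /andP[b0 bs]; apply: Pr.
  rewrite -ball_normE /= -addrA opprD addNKr normrN.
  apply: le_lt_trans (ler_normD _ _) _; rewrite !normrZ !ger0_norm//.
  apply: (@le_lt_trans _ _ (s * N)); last by rewrite -ltr_pdivlMr.
  rewrite /N !mulrDr mulr1; apply: ler_wpDr; first exact: ltW.
  by apply: lerD; apply: ler_wpM2r.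
apply/eqP; rewrite -subr_eq0 -normr_le0; apply/ler_addgt0Pl => e e0.
rewrite addr0.
have e20 : 0 < e / 2 by rewrite divr_gt0.
have near1 w1 w2 :
    nbhs x [set y | `|'D_w2 ('D_w1 f) x - 'D_w2 ('D_w1 f) y| < e / 2].
  by have /cvgrPdist_lt := cont w1 w2; exact.
have [e1 e10 H1] := near_square _ (filterI (open_nbhs_nbhs (conj oU Ux))
  (filterI (near1 u v) (near1 v u))).
pose s := e1 / 2.
have se : 0 < s < e1 by rewrite /s divr_gt0//= ltr_pdivrMr// ltr_pMr// ltr1n.
have s0 : 0 < s by case/andP: se.
have [a [b [as_ bs E1]]] := second_difference_mvt Cf s0
  (fun a b ha hb => (H1 s se a b ha hb).1).
have [b' [a' [bs' as' E2]]] := second_difference_mvt Cf s0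
  (fun b a hb ha => eq_ind _ U (H1 s se a b ha hb).1 _ (addrAC _ _ _)).
have E : 'D_v ('D_u f) (x + a *: u + b *: v)
    = 'D_u ('D_v f) (x + a' *: u + b' *: v).
  apply: (@mulIf _ (s ^+ 2)); first by rewrite expf_neq0// gt_eqF.
  rewrite [x + b' *: v + _]addrAC [x + s *: v + _]addrAC in E2.
  apply: (etrans (esym E1)); apply: etrans E2.
  move: (f (x + s *: u + s *: v)) (f (x + s *: u)) (f (x + s *: v)) (f x).
  by move=> A B C D; congr (_ + _); rewrite addrAC.
have [_ [h1 _]] := H1 s se a b as_ bs.
have [_ [_ h2]] := H1 s se a' b' as' bs'.
have key (A B C D d : R) :
    C = D -> `|A - C| < d / 2 -> `|B - D| < d / 2 -> `|B - A| <= d.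
  move=> <- AC BC; apply: le_trans (ler_distD C _ _) _.
  by rewrite [leRHS]splitr; apply: lerD; [| rewrite distrC]; exact: ltW.
exact: key E h1 h2.
Qed.

(** * Smoothness of projections and coordinates *)

Lemma continuous_fst (R : realType) (V W : normedModType R) :
  continuous (fst : V * W -> V).
Proof. by move=> z; exact: cvg_fst. Qed.

Lemma continuous_snd (R : realType) (V W : normedModType R) :
  continuous (snd : V * W -> W).
Proof. by move=> z; exact: cvg_snd. Qed.

Lemma open_fst (R : realType) (V W : normedModType R) (A : set V) :
  open A -> open [set z : V * W | A z.1].
Proof. by move=> oA; apply: open_comp => // z _; exact: cvg_fst. Qed.

Lemma Ck_on_fst (R : realType) (V V' W : normedModType R) (k : nat)
    (A : set V) (g : V -> W) : open A -> Ck_on k A g ->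
  Ck_on k [set z : V * V' | A z.1] (fun z => g z.1).
Proof.
move=> oA; apply: (@Ck_on_comp_linear _ _ _ _ k _ A fst g) => //.
  exact: open_fst.
exact: continuous_fst.
Qed.

Lemma is_derive_coord (R : realType) (n : nat) (i : 'I_n) (x v : 'rV[R]_n) :
  is_derive x v (fun x : 'rV[R]_n => x 0 i) (v 0 i).
Proof.
have dc : differentiable (fun x : 'rV[R]_n => x 0 i : R) x.
  exact: differentiable_coord.
apply: DeriveDef; first exact: diff_derivable.
have @f : {linear 'rV[R]_n -> R}.
  by exists (fun N : 'rV[R]_n => N 0 i); do 2![eexists]; do ?[constructor];
     rewrite ?mxE// => ? *; rewrite ?mxE//; move=> ?; rewrite !mxE.
rewrite deriveE// (_ : (fun x : 'rV[R]_n => _) = f)// diff_lin//.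
exact: coord_continuous.
Qed.

Lemma Ck_on_coord (R : realType) (n k : nat) (U : set 'rV[R]_n) (i : 'I_n) :
  Ck_on k U (fun x => x 0 i).
Proof.
case: k => [|k]; first by move=> x _; exact: coord_continuous.
split=> [x _|v]; first exact: differentiable_coord.
rewrite (_ : (fun x => _) = fun=> v 0 i); first exact: Ck_on_cst.
by apply/funext => x; have [_ ->] := is_derive_coord i x v.
Qed.

Lemma Ck_on_snd_coord (R : realType) (V : normedModType R) (n k : nat)
    (U : set (V * 'rV[R]_n)) (i : 'I_n) : open U ->
  Ck_on k U (fun z => z.2 0 i).
Proof.
move=> oU.
apply: (@Ck_on_comp_linear _ _ _ _ k U setT snd (fun x : 'rV[R]_n => x 0 i)) => //.
  exact: continuous_snd.
exact: Ck_on_coord.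
Qed.

(** * The real root *)

Lemma real_rootX (R : realType) (k : nat) (t : R) :
  (0 < k)%N -> odd k \/ 0 <= t -> real_root k t ^+ k = t.
Proof.
move=> k0 kt; rewrite /real_root exprMn.
rewrite -[(_ `^ _) ^+ k]powR_mulrn ?powR_ge0// -powRrM.
rewrite mulVf ?pnatr_eq0 -?lt0n// powRr1//.
have [t0|t0|->] := ltgtP t 0; last by rewrite normr0 mulr0.
- case: kt => [ok|]; last by rewrite leNgt t0.
  by rewrite ltr0_sg// ltr0_norm// -signr_odd ok mulN1r opprK.
- by rewrite gtr0_sg// gtr0_norm// expr1n mul1r.
Qed.

Lemma real_root_eq0 (R : realType) (k : nat) (t : R) :
  t != 0 -> real_root k t != 0.
Proof.
by move=> t0; rewrite mulf_neq0 ?sgr_eq0// gt_eqF// powR_gt0// normr_gt0.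
Qed.

(** Near [t] the sign [c] is constant, so the root is [c (c s)^a] with [c s > 0] and the power rule
    applies. Writing the derivative as a multiple of the root itself lets the induction in
    [Ck_on_real_root] close. *)
Lemma is_derive_real_root (R : realType) (k : nat) (t : R) : t != 0 ->
  is_derive t (1 : R) (real_root k) (real_root k t * (k%:R^-1 * t^-1)).
Proof.
move=> t0; set c := Num.sg t; set a : R := k%:R^-1.
have c2 : c * c = 1 by rewrite /c -expr2 sqr_sg t0.
have ct : 0 < c * t by rewrite /c -normrEsg normr_gt0.
apply: (@near_eq_is_derive _ _ _ (fun s : R => c * (c * s) `^ a)).
  have : \forall s \near t, 0 < c * s.
    have cc : {for t, continuous (fun s : R => c * s)}.
      by apply: cvgM; [exact: cvg_cst | exact: cvg_id].
    exact: (cc [set r | 0 < r] (lt_nbhsr ct)).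
  apply: filterS => s cs; rewrite /real_root.
  have cs1 : Num.sg s = c.
    have s0 : s != 0 by apply: contraTneq cs => ->; rewrite mulr0 ltxx.
    have : Num.sg (c * s) = 1 by rewrite gtr0_sg.
    rewrite sgrM sgr_id => /(congr1 ( *%R c)).
    by rewrite mulrA c2 mul1r mulr1.
  by rewrite normrEsg cs1.
have dl : is_derive t (1 : R) (fun s : R => c * s) c.
  have : is_derive t (1 : R) (c \*: (id : R -> R)) (c *: 1) by exact: is_deriveZ.
  by rewrite [c *: 1]mulr1.
have dc : is_derive t (1 : R) (fun s : R => (c * s) `^ a)
    (c * (a * (c * t) `^ (a - 1))).
  have [dl1 dl2] := dl.
  have dp : is_derive (c * t) (1 : R) (@powR R ^~ a) (a * (c * t) `^ (a - 1)).
    exact: is_derive1_powR.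
  have [dp1 dp2] := dp.
  apply: DeriveDef.
    apply: diff_derivable.
    apply: (@differentiable_comp _ _ _ _ (fun s : R => c * s) (@powR R ^~ a)).
      by apply/derivable1_diffP.
    by apply/derivable1_diffP.
  rewrite -derive1E (@derive1_comp R (fun s : R => c * s) (@powR R ^~ a))//.
  by rewrite !derive1E dl2 dp2 mulrC.
have : is_derive t (1 : R) (c \*: (fun s : R => (c * s) `^ a))
   (c *: (c * (a * (c * t) `^ (a - 1)))) by exact: is_deriveZ.
congr (is_derive _ _ _ _).
rewrite /real_root -/c normrEsg -/c -/a /GRing.scale/=.
rewrite powRB; last by rewrite (gt_eqF ct) implybT.
rewrite powRr1 ?ltW//.
have c0 : c != 0 by rewrite /c sgr_eq0.
by field; rewrite c0 t0.
Qed.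

Lemma Ck_on_real_root (R : realType) (V : normedModType R) (p k : nat)
    (U : set V) (f : V -> R) : open U -> (forall x, U x -> f x != 0) ->
  Ck_on k U f -> Ck_on k U (fun x => real_root p (f x)).
Proof.
move=> oU f0.
have dr t : t != 0 -> differentiable (real_root p : R -> R) t.
  by move=> t0; apply/derivable1_diffP; have [] := is_derive_real_root p t0.
elim: k => [|k IH].
  move=> cf x Ux; apply: continuous_comp; first exact: (cf x Ux).
  by apply: differentiable_continuous; apply: dr; exact: f0.
move=> Cf; have [df Df] := Cf; split=> [x Ux|v].
  by apply: differentiable_comp; [exact: df | apply: dr; exact: f0].
have Cf' := Ck_onW Cf.
have C2 := Ck_onM oU (IH Cf') (Ck_onM oU
  (Ck_onM oU (Ck_on_cst k U (p%:R^-1 : R))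
    (Ck_onV oU f0 Cf')) (Df v)).
apply: (eq_Ck_on oU _ C2) => x Ux.
have dx := df x Ux; have dr' := dr _ (f0 _ Ux).
rewrite [RHS]deriveE; last exact: differentiable_comp.
rewrite diff_comp// /= -(deriveE v dx) diff1E// derive1E.
have [_ ->] := is_derive_real_root p (f0 _ Ux).
by rewrite /GRing.scale/= [RHS]mulrC !mulrA.
Qed.

(** * Forms on lines *)

(** The bound forces [p(0) = 0] in the limit; dividing by ['X] then lowers both the size and the
    exponent by one. On the punctured neighbourhood the division by [|s|] is legitimate. *)
Lemma poly_bigO_eq0 (R : realType) (k : nat) (C : R) (p : {poly R}) :
  (size p <= k)%N ->
  (\forall s \near (0 : R)^', `|p.[s]| <= C * `|s| ^+ k) -> p = 0.
Proof.
elim: k p => [|k IH] p; first by rewrite leqn0 size_poly_eq0 => /eqP.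
move=> sp pO.
have p0 : p.[0] = 0.
  have c1 : (fun s => `|p.[s]|) @ (0 : R)^' --> `|p.[0]|.
    apply: cvg_norm; apply: cvg_within_filter; exact: continuous_horner.
  have c2 : (fun s : R => C * `|s| ^+ k.+1) @ (0 : R)^' --> (0 : R).
    have : (fun s : R => C * `|s| ^+ k.+1) @ (0 : R)^' --> C * `|0 : R| ^+ k.+1.
      apply: cvgM; first exact: cvg_cst.
      have cn : (fun s : R => `|s|) @ (0 : R)^' --> `|0 : R|.
        by apply: cvg_norm; apply: cvg_within_filter; exact: cvg_id.
      exact: cvg_comp cn (@exprn_continuous R k.+1 _).
    by rewrite normr0 expr0n mulr0.
  apply/eqP; rewrite -normr_le0.
  by apply: ler_cvg_to c1 c2 _.
have [q pq] : exists q, p = q * 'X.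
  have /factor_theorem[q ->] : root p 0 by exact/rootP.
  by exists q; rewrite subr0.
have [q0|q0] := eqVneq q 0; first by rewrite pq q0 mul0r.
rewrite pq (IH q) ?mul0r//.
  by move: sp; rewrite pq size_mulX.
near=> s.
have s0 : 0 < `|s|.
  by rewrite normr_gt0; near: s; exact: nbhs_dnbhs_neq.
have : `|p.[s]| <= C * `|s| ^+ k.+1 by near: s.
by rewrite pq hornerMX normrM exprS [C * _]mulrCA mulrC ler_pM2l.
Unshelve. all: by end_near. Qed.

(** The restriction of the form over [x] to the line [y + s v], as a polynomial in [s]. *)
Definition form_line (R : realType) (n k : nat)
    (a : {ffun 'I_k -> 'I_n} -> 'rV[R]_n -> R) (x y v : 'rV[R]_n) : {poly R} :=
  \sum_(I : {ffun 'I_k -> 'I_n})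
    a I x *: \prod_(j < k) ((y 0 (I j))%:P + v 0 (I j) *: 'X).

Lemma size_form_line (R : realType) (n k : nat)
    (a : {ffun 'I_k -> 'I_n} -> 'rV[R]_n -> R) (x y v : 'rV[R]_n) :
  (size (form_line a x y v) <= k.+1)%N.
Proof.
apply: leq_trans (size_sum _ _ _) _; apply/bigmax_leqP => I _.
apply: leq_trans (size_scale_leq _ _) _.
(* A product of [k] factors has size at most one plus the sum of their sizes minus [k]; affine
   factors have size at most 2, whence [2k + 1 - k = k + 1]. *)
apply: leq_trans (size_prod_leq _ _) _.
rewrite card_ord leq_subLR.
apply: (@leq_trans (\sum_(j < k) 2).+1); last first.
  by rewrite sum_nat_const card_ord; lia.
rewrite ltnS; apply: leq_sum => j _.
apply: leq_trans (size_polyD _ _) _; rewrite geq_max.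
rewrite (leq_trans (size_polyC_leq1 _))//=.
by apply: leq_trans (size_scale_leq _ _) _; rewrite size_polyX.
Qed.

Lemma horner_form_line (R : realType) (n k : nat)
    (a : {ffun 'I_k -> 'I_n} -> 'rV[R]_n -> R) (x y v : 'rV[R]_n) (s : R) :
  (form_line a x y v).[s] = form_eval a (x, y + s *: v).
Proof.
rewrite /form_line horner_sum; apply: eq_bigr => I _.
rewrite hornerZ horner_prod; congr (_ * _); apply: eq_bigr => j _.
by rewrite hornerD hornerC hornerZ hornerX !mxE [s * _]mulrC.
Qed.

(** * Functions on the tangent bundle *)

Lemma smooth_form_eval (R : realType) (n k : nat) (A : set 'rV[R]_n)
    (a : {ffun 'I_k -> 'I_n} -> 'rV[R]_n -> R) : open A ->
  (forall I, smooth_on A (a I)) -> smooth_on [set z | A z.1] (form_eval a).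
Proof.
move=> oA sa l; have oU := @open_fst _ 'rV[R]_n 'rV[R]_n _ oA.
apply: Ck_on_sum => // I _; apply: Ck_onM => //.
  by apply: Ck_on_fst => //; exact: sa.
by apply: Ck_on_prod => // j _; exact: Ck_on_snd_coord.
Qed.

Lemma open_cimg (R : realType) (n : nat) (M : manifold R n) (a : atlas M) :
  open (cimg (chart_of a)).
Proof. exact: cimg_open. Qed.

Lemma open_tangent_chart (R : realType) (n : nat) (M : manifold R n)
    (a : atlas M) :
  open [set z : 'rV[R]_n * 'rV[R]_n | cimg (chart_of a) z.1].
Proof. by apply: open_fst; exact: open_cimg. Qed.

Lemma smooth_rquad (R : realType) (n : nat) (M : manifold R n)
    (gamma : riemannian M) (a : atlas M) :
  smooth_on [set z | cimg (chart_of a) z.1] (rquad gamma a).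
Proof.
move=> l; have oU := @open_tangent_chart _ _ _ a.
apply: Ck_on_sum => // i _; apply: Ck_on_sum => // j _.
do 2 (apply: Ck_onM => //; last exact: Ck_on_snd_coord).
apply: (@Ck_on_fst _ _ _ _ l _ (fun x => rmx gamma a x i j)).
  exact: open_cimg.
exact: rmx_smooth.
Qed.

Lemma smooth_homogeneous (R : realType) (n k : nat) (M : manifold R n)
    (f : tm_fun M) (a : atlas M) : homogeneous_polynomial k f ->
  smooth_on [set z | cimg (chart_of a) z.1] (f a).
Proof.
move=> [_ /(_ a)[b [sb fb]]] l; have oU := @open_tangent_chart _ _ _ a.
apply: eq_Ck_on (smooth_form_eval (@open_cimg _ _ _ a) sb l) => //.
by move=> [x y] /= Ux; rewrite fb.
Qed.

(** * Partial derivatives in induced coordinates *)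

Lemma derive_coordinates (R : realType) (n : nat)
    (f : 'rV[R]_n * 'rV[R]_n -> R) (z : 'rV[R]_n * 'rV[R]_n) (u w : 'rV[R]_n) :
  differentiable f z ->
  'D_(u, w) f z = \sum_i u 0 i * dx i f z + \sum_i w 0 i * dy i f z.
Proof.
move=> df; rewrite deriveE//.
have -> : (u, w) = \sum_i u 0 i *: ((basis_vec R n i, 0) : 'rV[R]_n * 'rV[R]_n)
                 + \sum_i w 0 i *: ((0, basis_vec R n i) : 'rV[R]_n * 'rV[R]_n).
  have -> : (u, w) = (u, 0) + (0, w) by congr pair; rewrite /= ?addr0 ?add0r.
  congr (_ + _).
    rewrite [in LHS](row_sum_delta u) (big_morph (fun u => (u, 0 : 'rV[R]_n))
      (id1 := 0) (op1 := +%R)) //.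
      by apply: eq_bigr => i _; congr pair; rewrite /= ?scaler0.
    by move=> p q; congr pair; rewrite /= addr0.
  rewrite [in LHS](row_sum_delta w) (big_morph (fun w => (0 : 'rV[R]_n, w))
    (id1 := 0) (op1 := +%R)) //.
    by apply: eq_bigr => i _; congr pair; rewrite /= ?scaler0.
  by move=> p q; congr pair; rewrite /= addr0.
rewrite linearD !linear_sum; congr (_ + _); apply: eq_bigr => i _;
  by rewrite linearZ /= -deriveE.
Qed.

Lemma dxE (R : realType) (n : nat) (i : 'I_n)
    (f : 'rV[R]_n * 'rV[R]_n -> R) (x y : 'rV[R]_n) :
  dx i f (x, y) = 'D_(basis_vec R n i) (fun x' => f (x', y)) x.
Proof.
rewrite /dx /derive.
suff -> : (fun h : R =>
    h^-1 *: ((f \o shift (x, y)) (h *: (basis_vec R n i, 0)) - f (x, y)))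
    = fun h => h^-1 *: (f (h *: basis_vec R n i + x, y) - f (x, y)) by [].
apply/funext => h /=.
by rewrite (_ : h *: _ + (x, y) = (h *: basis_vec R n i + x, y))//;
  congr pair; rewrite /= scaler0 add0r.
Qed.

Lemma dyE (R : realType) (n : nat) (i : 'I_n)
    (f : 'rV[R]_n * 'rV[R]_n -> R) (x y : 'rV[R]_n) :
  dy i f (x, y) = 'D_(basis_vec R n i) (fun y' => f (x, y')) y.
Proof.
rewrite /dy /derive.
suff -> : (fun h : R =>
    h^-1 *: ((f \o shift (x, y)) (h *: (0, basis_vec R n i)) - f (x, y)))
    = fun h => h^-1 *: (f (x, h *: basis_vec R n i + y) - f (x, y)) by [].
apply/funext => h /=.
by rewrite (_ : h *: _ + (x, y) = (x, h *: basis_vec R n i + y))//;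
  congr pair; rewrite /= scaler0 add0r.
Qed.

Lemma is_derive_sumf (R : realType) (V : normedModType R) (n : nat)
    (h : 'I_n -> V -> R) (x v : V) (dh : 'I_n -> R) :
  (forall i, is_derive x v (h i) (dh i)) ->
  is_derive x v (fun x => \sum_i h i x) (\sum_i dh i).
Proof.
move=> dh_; have := @is_derive_sum R V R n h x v dh dh_.
by congr is_derive; apply/funext => y; rewrite fct_sumE.
Qed.

Lemma is_derive_mull (R : realType) (V : normedModType R)
    (h : V -> R) (x v : V) (dh c : R) :
  is_derive x v h dh -> is_derive x v (fun x => c * h x) (c * dh).
Proof. exact: is_deriveZ. Qed.

Lemma is_derive_mulr (R : realType) (V : normedModType R)
    (h : V -> R) (x v : V) (dh c : R) :
  is_derive x v h dh -> is_derive x v (fun x => h x * c) (dh * c).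
Proof.
move=> hd; have := is_derive_mull c hd.
by rewrite [c * dh]mulrC; congr is_derive; apply/funext => y; rewrite [LHS]mulrC.
Qed.

Lemma is_derive_mulf (R : realType) (V : normedModType R)
    (f g : V -> R) (x v : V) (df dg : R) :
  is_derive x v f df -> is_derive x v g dg ->
  is_derive x v (fun x => f x * g x) (f x * dg + g x * df).
Proof. exact: is_deriveM. Qed.

(** * Christoffel symbols and metricity *)

Lemma rmx_differentiable (R : realType) (n : nat) (M : manifold R n)
    (gamma : riemannian M) (a : atlas M) (x : 'rV[R]_n) (i j : 'I_n) :
  cimg (chart_of a) x -> differentiable (fun x => rmx gamma a x i j) x.
Proof. by move=> Ux; have [+ _] := @rmx_smooth _ _ _ gamma a i j 1; exact. Qed.

Lemma derive_rmx_sym (R : realType) (n : nat) (M : manifold R n)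
    (gamma : riemannian M) (a : atlas M) (x v : 'rV[R]_n) (i j : 'I_n) :
  cimg (chart_of a) x ->
  'D_v (fun x => rmx gamma a x i j) x = 'D_v (fun x => rmx gamma a x j i) x.
Proof.
move=> Ux; apply: near_eq_derive.
apply: filterS (open_nbhs_nbhs (conj (@open_cimg _ _ _ a) Ux)) => x' Ux'.
exact: rmx_sym.
Qed.

Lemma christoffel_sym (R : realType) (n : nat) (M : manifold R n)
    (gamma : riemannian M) (a : atlas M) (x : 'rV[R]_n) (i j k : 'I_n) :
  cimg (chart_of a) x ->
  christoffel gamma a x i j k = christoffel gamma a x i k j.
Proof.
move=> Ux; rewrite /christoffel; congr (_ * _); apply: eq_bigr => l _.
rewrite (derive_rmx_sym gamma _ l k Ux) (derive_rmx_sym gamma _ j l Ux).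
by rewrite (derive_rmx_sym gamma _ j k Ux) [in LHS](addrC ('D__ _ _)).
Qed.

Lemma bilin_mulmx (R : realType) (n : nat) (G : 'M[R]_n) (u v : 'rV[R]_n) :
  bilin G u v = (u *m G *m v^T) 0 0.
Proof.
rewrite mxE /bilin exchange_big; apply: eq_bigr => j _.
by rewrite mxE mulr_suml !mxE; apply: eq_bigr => i _; rewrite [G i j * _]mulrC.
Qed.

(** A nonzero vector in the kernel would have zero length, against positivity. *)
Lemma rmx_unit (R : realType) (n : nat) (M : manifold R n)
    (gamma : riemannian M) (a : atlas M) (x : 'rV[R]_n) :
  cimg (chart_of a) x -> rmx gamma a x \in unitmx.
Proof.
move=> Ux; rewrite unitmxE unitfE; apply/det0P => -[v v0 vG].
have := rmx_pos gamma Ux v0.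
by rewrite bilin_mulmx vG mul0mx mxE ltxx.
Qed.

(** Lowering the upper index cancels the inverse matrix and leaves the Christoffel symbols of the
    first kind. *)
Lemma lower_christoffel (R : realType) (n : nat) (M : manifold R n)
    (gamma : riemannian M) (a : atlas M) (x : 'rV[R]_n) (s i k : 'I_n) :
  cimg (chart_of a) x ->
  \sum_r rmx gamma a x r s * christoffel gamma a x r i k =
  2^-1 * ('D_(basis_vec R n i) (fun x' => rmx gamma a x' s k) x
     + 'D_(basis_vec R n k) (fun x' => rmx gamma a x' i s) x
     - 'D_(basis_vec R n s) (fun x' => rmx gamma a x' i k) x).
Proof.
move=> Ux; rewrite /christoffel.
pose d l := 'D_(basis_vec R n i) (fun x' => rmx gamma a x' l k) x
     + 'D_(basis_vec R n k) (fun x' => rmx gamma a x' i l) x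
     - 'D_(basis_vec R n l) (fun x' => rmx gamma a x' i k) x.
rewrite -/(d s).
transitivity (2^-1 * \sum_r \sum_l rmx gamma a x s r * invmx (rmx gamma a x) r l
  * d l).
  rewrite mulr_sumr; apply: eq_bigr => r _; rewrite mulrCA mulr_sumr.
  rewrite (rmx_sym gamma _ _ Ux); congr (_ * _).
  by apply: eq_bigr => l _; rewrite mulrA.
congr (_ * _); rewrite exchange_big /= (bigD1 s)//= [X in _ + X]big1 ?addr0.
  rewrite -mulr_suml (_ : \sum_i _ = (rmx gamma a x *m invmx (rmx gamma a x)) s s).
    by rewrite mulmxV ?rmx_unit// mxE eqxx mul1r.
  by rewrite mxE.
move=> l ls; rewrite -mulr_suml.
rewrite (_ : \sum_i _ = (rmx gamma a x *m invmx (rmx gamma a x)) s l).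
  by rewrite mulmxV ?rmx_unit// mxE eq_sym (negPf ls) mul0r.
by rewrite mxE.
Qed.

Lemma dx_rquad (R : realType) (n : nat) (M : manifold R n)
    (gamma : riemannian M) (a : atlas M) (x y : 'rV[R]_n) (i : 'I_n) :
  cimg (chart_of a) x ->
  dx i (rquad gamma a) (x, y) = \sum_j \sum_k
    'D_(basis_vec R n i) (fun x => rmx gamma a x j k) x * y 0 j * y 0 k.
Proof.
move=> Ux; rewrite dxE; apply: derive_val.
apply: is_derive_sumf => j; apply: is_derive_sumf => k.
do 2 apply: is_derive_mulr; apply: DeriveDef => //.
by apply: diff_derivable; exact: rmx_differentiable.
Qed.

Lemma basis_vecE (R : realType) (n : nat) (i j : 'I_n) :
  basis_vec R n i 0 j = (i == j)%:R.
Proof. by rewrite mxE eqxx eq_sym. Qed.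

Lemma sum_delta (R : realType) (n : nat) (i : 'I_n) (f : 'I_n -> R) :
  \sum_j f j * (i == j)%:R = f i.
Proof.
rewrite (bigD1 i)//= eqxx mulr1 big1 ?addr0// => j ji.
by rewrite eq_sym (negPf ji) mulr0.
Qed.

Lemma dy_rquad (R : realType) (n : nat) (M : manifold R n)
    (gamma : riemannian M) (a : atlas M) (x y : 'rV[R]_n) (i : 'I_n) :
  cimg (chart_of a) x ->
  dy i (rquad gamma a) (x, y) = 2 * \sum_k rmx gamma a x i k * y 0 k.
Proof.
move=> Ux; rewrite dyE.
transitivity (\sum_j \sum_k (rmx gamma a x j k * y 0 j * (i == k)%:R +
   y 0 k * (rmx gamma a x j k * (i == j)%:R))).
  apply: derive_val.
  apply: is_derive_sumf => j; apply: is_derive_sumf => k.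
  apply: is_derive_mulf.
    by rewrite /= -basis_vecE; apply: is_derive_mull; exact: is_derive_coord.
  rewrite -basis_vecE; exact: is_derive_coord.
under eq_bigr do rewrite big_split /= sum_delta.
rewrite big_split /= mulrDl mul1r; congr (_ + _).
  by apply: eq_bigr => j _; rewrite (rmx_sym gamma _ _ Ux).
rewrite exchange_big /=; apply: eq_bigr => k _.
rewrite -mulr_sumr sum_delta mulrC; congr (_ * _).
Qed.

Lemma dydy_rquad (R : realType) (n : nat) (M : manifold R n)
    (gamma : riemannian M) (a : atlas M) (x y : 'rV[R]_n) (i j : 'I_n) :
  cimg (chart_of a) x ->
  dy i (dy j (rquad gamma a)) (x, y) = 2 * rmx gamma a x i j.
Proof.
move=> Ux; rewrite dyE.
under eq_fun do rewrite dy_rquad//.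
rewrite (rmx_sym gamma _ _ Ux).
rewrite -[in RHS](sum_delta i (rmx gamma a x j)).
apply: derive_val.
apply: is_derive_mull; apply: is_derive_sumf => k.
by rewrite -basis_vecE; apply: is_derive_mull; exact: is_derive_coord.
Qed.

(** Metricity of the connection: [N^r_i dq/dy^r] is the sum of the first-kind symbols against
    [2 y^k y^s]. Two of the three derivatives of [gamma] are exchanged by swapping [k] and [s] and
    cancel; the third gives [dq/dx^i]. *)
Lemma covariant_rquad (R : realType) (n : nat) (M : manifold R n)
    (gamma : riemannian M) (a : atlas M) (x y : 'rV[R]_n) (i : 'I_n) :
  cimg (chart_of a) x ->
  covariant_derivative gamma (rquad gamma) a (x, y) i = 0.
Proof.
move=> Ux; rewrite /covariant_derivative dx_rquad//.
pose d (i j k : 'I_n) := 'D_(basis_vec R n i) (fun x => rmx gamma a x j k) x.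
apply/eqP; rewrite subr_eq0; apply/eqP; symmetry.
transitivity (\sum_k \sum_s (d i s k + d k i s - d s i k) * (y 0 k * y 0 s)).
  transitivity (\sum_k \sum_s \sum_r
    2 * (rmx gamma a x r s * christoffel gamma a x r i k) * (y 0 k * y 0 s)).
    under [RHS]eq_bigr do rewrite exchange_big.
    rewrite [RHS]exchange_big; apply: eq_bigr => r _.
    rewrite dy_rquad// /nonlinear_connection mulr_suml; apply: eq_bigr => k _.
    rewrite !mulr_sumr; apply: eq_bigr => s _ /=; ring.
  apply: eq_bigr => k _; apply: eq_bigr => s _.
  by rewrite -mulr_suml -mulr_sumr lower_christoffel// mulVKf ?pnatr_eq0.
transitivity (\sum_k \sum_s d i s k * (y 0 k * y 0 s)
  + (\sum_k \sum_s d k i s * (y 0 k * y 0 s)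
     - \sum_k \sum_s d s i k * (y 0 k * y 0 s))).
  rewrite -sumrB -big_split /=; apply: eq_bigr => k _.
  rewrite -sumrB -big_split /=; apply: eq_bigr => s _.
  by rewrite !mulrDl mulNr addrA.
rewrite [X in _ + (_ - X)]exchange_big /= [X in _ + X](_ : _ = 0) ?addr0; last first.
  apply/eqP; rewrite subr_eq0; apply/eqP; apply: eq_bigr => k _.
  by apply: eq_bigr => s _; rewrite [y 0 k * _]mulrC.
rewrite exchange_big; apply: eq_bigr => j _; apply: eq_bigr => k _.
by rewrite [y 0 k * _]mulrC mulrA.
Qed.

(** * Horizontal constancy and the Euler-Lagrange equations *)

(** The chain rule for [g = phi(f)] with [c] the derivative of [phi] at [f(z)]; it serves for the
    powers of [F]. *)
Lemma covariant_chain (R : realType) (n : nat) (M : manifold R n)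
    (gamma : riemannian M) (f g : tm_fun M) (a : atlas M)
    (z : 'rV[R]_n * 'rV[R]_n) (i : 'I_n) (c : R) :
  (forall v, 'D_v (g a) z = c * 'D_v (f a) z) ->
  covariant_derivative gamma g a z i = c * covariant_derivative gamma f a z i.
Proof.
move=> gf; rewrite /covariant_derivative /dx /dy gf mulrBr mulr_sumr.
by congr (_ - _); apply: eq_bigr => r _; rewrite gf mulrCA.
Qed.

Lemma covariantM (R : realType) (n : nat) (M : manifold R n)
    (gamma : riemannian M) (f g : tm_fun M) (a : atlas M)
    (z : 'rV[R]_n * 'rV[R]_n) (i : 'I_n) :
  differentiable (f a) z -> differentiable (g a) z ->
  covariant_derivative gamma (fun a z => f a z * g a z) a z i =
  f a z * covariant_derivative gamma g a z i
  + g a z * covariant_derivative gamma f a z i.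
Proof.
move=> df dg; have DM v : 'D_v (fun z => f a z * g a z) z =
    f a z * 'D_v (g a) z + g a z * 'D_v (f a) z.
  by apply: derive_val; apply: is_derive_mulf; apply/derivableP/diff_derivable.
rewrite /covariant_derivative /dx /dy DM !mulrBr addrACA -opprD; congr (_ - _).
rewrite !mulr_sumr -big_split; apply: eq_bigr => r _ /=.
by rewrite DM mulrDr !(mulrCA _ (nonlinear_connection _ _ _ _ _)).
Qed.

(* The components of [c'' + Gamma(c', c')]. *)
Definition acceleration (R : realType) (n : nat) (M : manifold R n)
    (gamma : riemannian M) (a : atlas M) (xi : R -> 'rV[R]_n) (t : R)
    (r : 'I_n) : R :=
  'D_1 ('D_1 xi) t 0 r
  + \sum_i 'D_1 xi t 0 i * nonlinear_connection gamma a (xi t, 'D_1 xi t) r i.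

Lemma differentiable_lift (R : realType) (n : nat) (xi : R -> 'rV[R]_n) (t : R) :
  differentiable xi t -> differentiable ('D_1 xi) t ->
  differentiable (fun s => (xi s, 'D_1 xi s)) t /\
  'D_1 (fun s => (xi s, 'D_1 xi s)) t = ('D_1 xi t, 'D_1 ('D_1 xi) t).
Proof.
move=> d1 d2; have d := differentiable_pair d1 d2; split=> //.
by rewrite !deriveE// diff_pair.
Qed.

(** Horizontal constancy replaces each [df/dx^i] in the chain rule by [N^r_i df/dy^r], and the
    coefficients of [df/dy^r] then add up to the covariant acceleration. *)
Lemma derive_lift (R : realType) (n : nat) (M : manifold R n)
    (gamma : riemannian M) (f : tm_fun M) (a : atlas M)
    (xi : R -> 'rV[R]_n) (t : R) :
  differentiable xi t -> differentiable ('D_1 xi) t ->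
  differentiable (f a) (xi t, 'D_1 xi t) ->
  (forall i, covariant_derivative gamma f a (xi t, 'D_1 xi t) i = 0) ->
  is_derive t (1 : R) (fun s => f a (xi s, 'D_1 xi s))
    (\sum_r acceleration gamma a xi t r * dy r (f a) (xi t, 'D_1 xi t)).
Proof.
move=> d1 d2 df cf; have [dl El] := differentiable_lift d1 d2.
have := is_derive_curve dl df; rewrite El derive_coordinates//.
congr is_derive.
rewrite addrC /acceleration.
under [RHS]eq_bigr do rewrite mulrDl.
rewrite big_split /=; congr (_ + _).
under [RHS]eq_bigr do rewrite mulr_suml.
rewrite exchange_big /=; apply: eq_bigr => i _.
have /eqP := cf i; rewrite subr_eq0 => /eqP ->.
by rewrite mulr_sumr; apply: eq_bigr => r _; rewrite mulrA.
Qed.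

Lemma dy_connection (R : realType) (n : nat) (M : manifold R n)
    (gamma : riemannian M) (a : atlas M) (x y : 'rV[R]_n) (r i j : 'I_n) :
  is_derive y (basis_vec R n i) (fun y => nonlinear_connection gamma a (x, y) r j)
    (christoffel gamma a x r j i).
Proof.
rewrite -(sum_delta i (christoffel gamma a x r j)).
apply: is_derive_sumf => k /=; rewrite -basis_vecE.
by apply: is_derive_mull; exact: is_derive_coord.
Qed.

Lemma is_derive_vertical (R : realType) (n : nat)
    (f : 'rV[R]_n * 'rV[R]_n -> R) (x y : 'rV[R]_n) (i : 'I_n) :
  differentiable f (x, y) ->
  is_derive y (basis_vec R n i) (fun y => f (x, y)) (dy i f (x, y)).
Proof.
move=> df; rewrite dyE; apply: derivableP; apply: diff_derivable.
exact: (@differentiable_comp _ _ _ _ (fun y => (x, y)) f).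
Qed.

(** The Euler-Lagrange expression of [L] is its vertical Hessian contracted with the covariant
    acceleration. The identity [L_{;j} = 0] is assumed on an open set because the proof
    differentiates it along the fibre. *)
Lemma derive_momentum (R : realType) (n : nat) (M : manifold R n)
    (gamma : riemannian M) (L : tm_fun M) (a : atlas M)
    (W : set ('rV[R]_n * 'rV[R]_n)) (xi : R -> 'rV[R]_n) (t : R) (i : 'I_n) :
  open W -> W (xi t, 'D_1 xi t) -> cimg (chart_of a) (xi t) ->
  Ck_on 2 W (L a) ->
  (forall z j, W z -> covariant_derivative gamma L a z j = 0) ->
  differentiable xi t -> differentiable ('D_1 xi) t ->
  is_derive t (1 : R) (fun s => dy i (L a) (xi s, 'D_1 xi s))
    (dx i (L a) (xi t, 'D_1 xi t)
     + \sum_r acceleration gamma a xi t r * dy i (dy r (L a)) (xi t, 'D_1 xi t)).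
Proof.
move=> oW Wt Ux CL covL d1 d2; have [dL DL] := CL.
have [dl El] := differentiable_lift d1 d2.
have dyL r z : W z -> differentiable (dy r (L a)) z.
  by have [+ _] := DL (0, basis_vec R n r); exact.
apply: is_derive_eq (is_derive_curve dl (dyL i _ Wt)) _.
rewrite El derive_coordinates; last exact: dyL.
move: Wt Ux.
set w := 'D_1 ('D_1 xi) t; set acc := acceleration gamma a xi t.
move Ex : (xi t) => x; move Ey : ('D_1 xi t) => y Wt Ux.
(* Partial derivatives commute, so this is the [y^i]-derivative of [dL/dx^j = N^r_j dL/dy^r]; the
   derivative of [N^r_j] is a Christoffel symbol. *)
have E1 j : dx j (dy i (L a)) (x, y) =
    \sum_r (christoffel gamma a x r j i * dy r (L a) (x, y)
    + nonlinear_connection gamma a (x, y) r j * dy i (dy r (L a)) (x, y)).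
  rewrite [LHS](derive_comm _ _ oW Wt CL).
  have -> : 'D_(0, basis_vec R n i) ('D_(basis_vec R n j, 0) (L a)) (x, y) =
    dy i (fun z => \sum_r nonlinear_connection gamma a z r j * dy r (L a) z) (x, y).
    apply: near_eq_derive; apply: filterS (open_nbhs_nbhs (conj oW Wt)) => z Wz.
    by have /eqP := covL z j Wz; rewrite subr_eq0 => /eqP.
  rewrite dyE; apply: derive_val; apply: is_derive_sumf => r.
  rewrite addrC mulrC [X in _ + X]mulrC.
  rewrite [X in is_derive _ _ _ (X + _)]mulrC.
  apply: is_derive_mulf; first exact: dy_connection.
  by apply: is_derive_vertical; exact: dyL.
have E2 r : dy r (dy i (L a)) (x, y) = dy i (dy r (L a)) (x, y).
  exact: (derive_comm _ _ oW Wt CL).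
(* Contracting with [y^j] and using the symmetry of the lower indices turns the Christoffel term
   into [N^r_i dL/dy^r], which is [dL/dx^i] by [L_{;i} = 0]. *)
have S1 : \sum_j y 0 j * dx j (dy i (L a)) (x, y) = dx i (L a) (x, y)
    + \sum_r (\sum_j y 0 j * nonlinear_connection gamma a (x, y) r j)
        * dy i (dy r (L a)) (x, y).
  transitivity (\sum_j y 0 j * \sum_r
     (christoffel gamma a x r j i * dy r (L a) (x, y)
      + nonlinear_connection gamma a (x, y) r j * dy i (dy r (L a)) (x, y))).
    by apply: eq_bigr => j _; congr (_ * _); exact: E1.
  have /eqP := covL _ i Wt; rewrite subr_eq0 => /eqP ->.
  move: {E1 E2} (fun r => dy r (L a) (x, y)) (fun r => dy i (dy r (L a)) (x, y)).
  move=> D DD.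
  under eq_bigr do rewrite big_split /= mulrDr.
  rewrite big_split /=; congr (_ + _).
    under eq_bigr do rewrite mulr_sumr.
    rewrite exchange_big /=; apply: eq_bigr => r _.
    rewrite /nonlinear_connection mulr_suml; apply: eq_bigr => j _ /=.
    by rewrite (christoffel_sym gamma r j i Ux) mulrA [y 0 j * _]mulrC.
  under eq_bigr do rewrite mulr_sumr.
  under [RHS]eq_bigr do rewrite mulr_suml.
  rewrite exchange_big /=; apply: eq_bigr => r _; apply: eq_bigr => j _.
  by rewrite mulrA.
have S2 : \sum_r w 0 r * dy r (dy i (L a)) (x, y)
    = \sum_r w 0 r * dy i (dy r (L a)) (x, y).
  by apply: eq_bigr => r _; exact: (congr1 ( *%R (w 0 r)) (E2 r)).
apply: (etrans (congr2 +%R S1 S2)).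
move: (dx i (L a) (x, y)) => D.
move: {E1 E2 S1 S2} (fun r => dy i (dy r (L a)) (x, y)) => DD.
rewrite -addrA; congr (_ + _).
rewrite addrC -big_split /=; apply: eq_bigr => r _.
by rewrite /acc /acceleration Ex Ey -mulrDl.
Qed.

Lemma near_eq_covariant (R : realType) (n : nat) (M : manifold R n)
    (gamma : riemannian M) (f g : tm_fun M) (a : atlas M)
    (z : 'rV[R]_n * 'rV[R]_n) (i : 'I_n) :
  (\forall w \near z, f a w = g a w) ->
  covariant_derivative gamma f a z i = covariant_derivative gamma g a z i.
Proof.
move=> fg; rewrite /covariant_derivative /dx /dy (near_eq_derive _ fg).
by congr (_ - _); apply: eq_bigr => r _; rewrite (near_eq_derive _ fg).
Qed.

Lemma open_preimage_on (V W : topologicalType) (U : set V) (P : set W)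
    (f : V -> W) : open U -> (forall x, U x -> {for x, continuous f}) ->
  open P -> open [set x | U x /\ P (f x)].
Proof.
move=> oU cf oP; rewrite openE => x [Ux Px]; apply: filterI.
  exact: open_nbhs_nbhs.
by apply: (cf x Ux); exact: open_nbhs_nbhs.
Qed.

(** The common hypothesis under which the geodesics of [F] are those of the connection of [gamma];
    it is verified below for both metrics. *)
Definition metric_compatible (R : realType) (n : nat) (M : manifold R n)
    (gamma : riemannian M) (F : fundamental M) : Prop :=
  forall a z, regular F a z ->
  exists W : set ('rV[R]_n * 'rV[R]_n),
    [/\ open W, W z, smooth_on W (fsquare F a),
        forall w i, W w -> covariant_derivative gamma (fsquare F) a w i = 0
      & \det (fundamental_tensor F a z) != 0].

(** Comparing the assumed derivative of the momentum with that of [derive_momentum] gives [H A = 0]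
    for the fundamental tensor [H] and the acceleration [A]; [H] is invertible. *)
Lemma euler_lagrangeP (R : realType) (n : nat) (M : manifold R n)
    (gamma : riemannian M) (F : fundamental M) (a : atlas M)
    (xi : R -> 'rV[R]_n) (t : R) :
  metric_compatible gamma F -> regular F a (xi t, 'D_1 xi t) ->
  differentiable xi t -> differentiable ('D_1 xi) t ->
  (forall i, is_derive t (1 : R)
     (fun s => dy i (fsquare F a) (xi s, 'D_1 xi s))
     (dx i (fsquare F a) (xi t, 'D_1 xi t))) <->
  (forall r, acceleration gamma a xi t r = 0).
Proof.
move=> cF rF d1 d2; have [W [oW Wt sW cW det0]] := cF _ _ rF.
have Ux : cimg (chart_of a) (xi t) by have [] := rF.
have DM i := derive_momentum i oW Wt Ux (sW 2) cW d1 d2.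
split=> [EL|acc0 i]; last first.
  apply: is_derive_eq (DM i) _; rewrite big1 ?addr0// => r _.
  by rewrite acc0 mul0r.
set H := fundamental_tensor F a (xi t, 'D_1 xi t) in det0.
pose A : 'cV[R]_n := \col_r acceleration gamma a xi t r.
have HA : H *m A = 0.
  apply/matrixP => i j; rewrite !mxE.
  transitivity (2^-1 * \sum_r acceleration gamma a xi t r *
     dy i (dy r (fsquare F a)) (xi t, 'D_1 xi t)).
    rewrite mulr_sumr; apply: eq_bigr => r _; rewrite !mxE.
    by rewrite -mulrA [X in _ * X]mulrC.
  have [[_ DMi] [_ ELi]] := (DM i, EL i).
  have /eqP := etrans (esym DMi) ELi.
  by rewrite addrC -subr_eq0 addrK => /eqP ->; rewrite mulr0.
have A0 : A = 0.
  have uH : H \in unitmx by rewrite unitmxE unitfE.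
  by rewrite -(mulKmx uH A) HA mulmx0.
by move=> r; have /matrixP/(_ r 0) := A0; rewrite !mxE.
Qed.

(** * The Riemannian fundamental function *)

Lemma rquad_ge0 (R : realType) (n : nat) (M : manifold R n)
    (gamma : riemannian M) (a : atlas M) (z : 'rV[R]_n * 'rV[R]_n) :
  cimg (chart_of a) z.1 -> 0 <= rquad gamma a z.
Proof.
move=> Ux; have [y0|y0] := eqVneq z.2 0; last by rewrite ltW// rmx_pos.
by rewrite /rquad y0 bilin_mulmx mul0mx mul0mx mxE.
Qed.

Lemma riemannian_regular (R : realType) (n : nat) (M : manifold R n)
    (gamma : riemannian M) (a : atlas M) (z : 'rV[R]_n * 'rV[R]_n) :
  cimg (chart_of a) z.1 -> z.2 != 0 ->
  regular (riemannian_fundamental gamma) a z.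
Proof.
move=> Ux y0; split=> //.
pose W := [set z | cimg (chart_of a) z.1 /\ [set r : R | 0 < r] (rquad gamma a z)].
have sq := @smooth_rquad _ _ _ gamma a.
have oW : open W.
  apply: open_preimage_on; last exact: open_gt.
    exact: open_tangent_chart.
  exact: (sq 0).
exists W; split=> //; first by split=> //; exact: rmx_pos.
move=> k.
have sub : W `<=` [set z | cimg (chart_of a) z.1] by move=> w [].
have q0 w : W w -> rquad gamma a w != 0 by move=> [_ /= q0]; rewrite gt_eqF.
(* Where the quadratic form is positive, [Num.sqrt] is [real_root 2], whose smoothness is known. *)
apply: eq_Ck_on (Ck_on_real_root 2 oW q0 (Ck_on_subset sub (sq k))) => //.
move=> w [_ /= q1].
by rewrite /real_root gtr0_sg// mul1r gtr0_norm// powR12_sqrt// ltW.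
Qed.

(** Over the whole chart [F^2] is the quadratic form of [gamma], so metricity gives horizontal
    constancy and the fundamental tensor is [gamma] itself. *)
Lemma riemannian_metric_compatible (R : realType) (n : nat) (M : manifold R n)
    (gamma : riemannian M) :
  metric_compatible gamma (riemannian_fundamental gamma).
Proof.
move=> a [x y] [Ux y0 _]; have oU := @open_tangent_chart _ _ _ a.
set U := [set z | _] in oU.
have FE w : U w -> rquad gamma a w = fsquare (riemannian_fundamental gamma) a w.
  by move=> Uw; rewrite /fsquare /= sqr_sqrtr// rquad_ge0.
have nE w : U w -> \forall w' \near w,
    rquad gamma a w' = fsquare (riemannian_fundamental gamma) a w'.
  by move=> Uw; apply: filterS (open_nbhs_nbhs (conj oU Uw)).
exists U; split=> //.
- by move=> k; apply: eq_Ck_on FE _ => //; exact: smooth_rquad.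
- move=> [x' y'] i Uw; rewrite -(near_eq_covariant _ _ (nE _ Uw)).
  exact: covariant_rquad.
- have -> : fundamental_tensor (riemannian_fundamental gamma) a (x, y)
      = rmx gamma a x.
    apply/matrixP => i j; rewrite mxE.
    have Uxy : U (x, y) by [].
    suff -> : dy i (dy j (fsquare (riemannian_fundamental gamma) a)) (x, y)
       = dy i (dy j (rquad gamma a)) (x, y)
      by rewrite dydy_rquad// mulKf ?pnatr_eq0.
    apply: near_eq_derive; apply: filterS (open_nbhs_nbhs (conj oU Uxy)) => w Uw.
    by apply/esym/near_eq_derive; exact: nE.
  by have := rmx_unit gamma Ux; rewrite unitmxE unitfE.
Qed.

(** * Regular directions of the root metric *)

Lemma derivable_bigO (R : realType) (f : R -> R) :
  derivable f 0 1 -> f 0 = 0 ->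
  exists C : R, \forall s \near (0 : R)^', `|f s| <= C * `|s|.
Proof.
(* As [f 0 = 0], the difference quotient is [f s / s], within 1 of the derivative for small [s]. *)
move=> df f0; exists (`|'D_1 f 0| + 1).
have : \forall s \near (0 : R)^', `|'D_1 f 0 - s^-1 * (f (s%:A + 0) - f 0)| <= 1.
  by have /cvgrPdist_le/(_ 1 ltr01) := df.
apply: filter_app; near=> s => /=.
have s0 : s != 0 by near: s; exact: nbhs_dnbhs_neq.
rewrite f0 subr0 addr0 [s%:A]mulr1 => h.
rewrite -ler_pdivrMr ?normr_gt0// -normfV -normrM mulrC.
rewrite -(subrK ('D_1 f 0) (s^-1 * f s)); apply: le_trans (ler_normD _ _) _.
by rewrite addrC lerD2l distrC.
Unshelve. all: by end_near. Qed.

(** At a regular zero of [alpha], [F] is [O(s)] on each fibre line, so [alpha q = F^(m+2)] is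
    [O(s^(m+2))]. Since [q] is bounded below and [alpha] has degree [m] on the line, [alpha]
    vanishes on the fibre, and the fundamental tensor is zero. *)
Lemma regular_root_neq0 (R : realType) (n m : nat) (M : manifold R n)
    (gamma : riemannian M) (alpha : tm_fun M) (a : atlas M)
    (z : 'rV[R]_n * 'rV[R]_n) :
  let F := root_fundamental (m + 2) (fun a z => alpha a z * rquad gamma a z) in
  homogeneous_polynomial m alpha -> regular F a z ->
  \det (fundamental_tensor F a z) != 0 -> alpha a z != 0.
Proof.
case: z => [x y] F [_ /(_ a)[b [sb alphaE]]] [Ux y0 [W [oW Wz WF sW]]].
rewrite /= in Ux y0; apply: contra_neq => az.
have T0 : alpha a (x, y) * rquad gamma a (x, y) = 0 by rewrite az mul0r.
have Fz : fval F a (x, y) = 0 by rewrite /= T0 /real_root sgr0 mul0r.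
have dF w : W w -> differentiable (fval F a) w by have [+ _] := sW 1; exact.
have lineE v (s : R) :
    (x, y) + s *: (0, v) = (x, y + s *: v) :> 'rV[R]_n * 'rV[R]_n.
  by congr pair; rewrite /= ?scaler0 ?addr0.
have alpha0 v : alpha a (x, y + v) = 0.
  have Wz0 : W ((x, y) + (0 : R) *: (0, v)) by rewrite lineE scale0r addr0.
  have [df _] := is_derive_line (dF _ Wz0).
  have [C Cf] : exists C : R, \forall s \near (0 : R)^',
      `|fval F a (x, y + s *: v)| <= C * `|s|.
    have [|C HC] := derivable_bigO df; first by rewrite scale0r addr0.
    by exists C; apply: filterS HC => s; rewrite lineE.
  have cl : {for (0 : R), continuous
      (fun s : R => (x, y) + s *: ((0, v) : 'rV[R]_n * 'rV[R]_n))}.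
    apply: cvgD; first exact: cvg_cst.
    by apply: cvgZr_tmp; exact: cvg_id.
  have q0 : 0 < rquad gamma a (x, y) by exact: rmx_pos.
  have nW : \forall s \near (0 : R), W (x, y + s *: v).
    have h : nbhs (0 : R) [set s | W ((x, y) + s *: (0, v))].
      exact: (cl _ (open_nbhs_nbhs (conj oW Wz0))).
    by apply: filterS h => s; rewrite /= lineE.
  (* This lower bound on the quadratic form allows dividing the estimate of [T] by it. *)
  have nq : \forall s \near (0 : R),
      rquad gamma a (x, y) / 2 < rquad gamma a (x, y + s *: v).
    have cq : {for (x, y), continuous (rquad gamma a)}.
      exact: (@smooth_rquad _ _ _ gamma a 0).
    have q2 : rquad gamma a (x, y) / 2 < rquad gamma a (x, y).
      by rewrite ltr_pdivrMr// ltr_pMr// ltr1n.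
    have h : nbhs (0 : R) [set s | rquad gamma a (x, y) / 2
        < rquad gamma a ((x, y) + s *: (0, v))].
      apply: (cl [set w | rquad gamma a (x, y) / 2 < rquad gamma a w]).
      by rewrite scale0r addr0; exact: (cq _ (lt_nbhsr q2)).
    by apply: filterS h => s; rewrite /= lineE.
  have p0 : form_line b x y v = 0.
    apply: (@poly_bigO_eq0 R (m + 2) (C ^+ (m + 2) / (rquad gamma a (x, y) / 2))).
      by rewrite addn2 (leq_trans (size_form_line _ _ _ _)).
    near=> s.
    have /WF Ws : W (x, y + s *: v) by near: s; exact: cvg_within nW.
    have qs : rquad gamma a (x, y) / 2 < rquad gamma a (x, y + s *: v).
      by near: s; exact: cvg_within nq.
    have Cs : `|fval F a (x, y + s *: v)| <= C * `|s| by near: s.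
    have q20 : 0 < rquad gamma a (x, y) / 2 by rewrite divr_gt0.
    rewrite horner_form_line -alphaE// mulrAC ler_pdivlMr// -exprMn.
    apply: le_trans (_ : `|fval F a (x, y + s *: v)| ^+ (m + 2) <= _); last first.
      by rewrite lerXn2r// nnegrE (le_trans _ Cs).
    rewrite -normrX real_rootX ?addn2// -?(addn2 m)// normrM.
    rewrite [`|rquad _ _ _|]ger0_norm; last exact: rquad_ge0.
    by rewrite ler_wpM2l// ltW.
  (* The polynomial vanishes identically, so it may be evaluated far from 0, here at [s = 1]. *)
  have := horner_form_line b x y v 1.
  by rewrite p0 horner0 scale1r -alphaE.
have F0 y' : fsquare F a (x, y') = 0.
  have := alpha0 (y' - y); rewrite addrC subrK /fsquare /= => ->.
  by rewrite mul0r /real_root sgr0 mul0r expr0n.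
have H0 : fundamental_tensor F a (x, y) = 0.
  apply/matrixP => i j; rewrite !mxE dyE.
  have -> : (fun y' => dy j (fsquare F a) (x, y')) = cst 0.
    apply/funext => y'; rewrite dyE.
    by under eq_fun do rewrite F0; rewrite derive_cst.
  by rewrite derive_cst mulr0.
(* The zero matrix is singular only in positive dimension; the nonzero vector [y] excludes
   [n = 0]. *)
have [//|/negPf D0] := eqVneq (\det (fundamental_tensor F a (x, y))) 0.
have : fundamental_tensor F a (x, y) \in unitmx by rewrite unitmxE unitfE D0.
move=> /(mulmxV); rewrite H0 mul0mx => /matrixP E10.
case/eqP: y0; apply/rowP => i; have /eqP := E10 i i.
by rewrite !mxE eqxx eq_sym oner_eq0.
Unshelve. all: by end_near. Qed.

(** The root is smooth away from 0, so smoothness of [T] passes to [F] on an open set of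
    directions. *)
Lemma root_regular (R : realType) (n k : nat) (M : manifold R n)
    (T : tm_fun M) (a : atlas M) (z : 'rV[R]_n * 'rV[R]_n) :
  smooth_on [set z | cimg (chart_of a) z.1] (T a) ->
  cimg (chart_of a) z.1 -> z.2 != 0 -> odd k \/ 0 <= T a z -> T a z != 0 ->
  regular (root_fundamental k T) a z.
Proof.
move=> sT Ux y0 kT Tz; split=> //.
(* Nonzero values in the domain of the root: an open set for either parity of [k]. *)
pose P := [set r : R | r != 0 /\ (odd k \/ 0 < r)].
have oP : open P.
  have -> : P = if odd k then [set r : R | r != 0] else [set r : R | 0 < r].
    apply/seteqP; split=> r; case: ifP => ok; rewrite /P /= ?ok.
    - by move=> [].
    - by move=> [_ []].
    - by move=> r0; split=> //; left.
    - by move=> r0; split; [rewrite gt_eqF | right].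
  by case: ifP => _; [exact: open_neq | exact: open_gt].
pose W := [set z | cimg (chart_of a) z.1 /\ P (T a z)].
have oW : open W.
  apply: open_preimage_on => //; first exact: open_tangent_chart.
  exact: (sT 0).
have sub : W `<=` [set z | cimg (chart_of a) z.1] by move=> w [].
exists W; split=> //.
- split=> //; split=> //; case: kT => [|T0]; [by left | right].
  by rewrite lt_neqAle eq_sym Tz.
- by move=> w [_ [_ []]] /=; [left | right; rewrite ltW].
- move=> l; apply: Ck_on_real_root => //; first by move=> w [_ []].
  exact: Ck_on_subset sub (sT l).
Qed.

(** From [T = F^k], [0 = T_{;i} = k F^(k-1) F_{;i}]. The factor is nonzero where [T] is, so
    [F_{;i} = 0] and [(F^2)_{;i} = 2 F F_{;i} = 0]. *)
Lemma root_metric_compatible (R : realType) (n k : nat) (M : manifold R n)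
    (gamma : riemannian M) (T : tm_fun M) : (0 < k)%N ->
  let F := root_fundamental k T in
  (forall a, smooth_on [set z | cimg (chart_of a) z.1] (T a)) ->
  (forall a z i, cimg (chart_of a) z.1 ->
     covariant_derivative gamma T a z i = 0) ->
  (forall a z, regular F a z ->
     T a z != 0 /\ \det (fundamental_tensor F a z) != 0) ->
  metric_compatible gamma F.
Proof.
move=> k0 F sT cT nT a z rz; have [Tz det0] := nT a z rz.
have [Ux y0 [W0 [oW0 W0z WF sW0]]] := rz.
pose W1 := [set z | cimg (chart_of a) z.1 /\ [set r : R | r != 0] (T a z)].
have oW1 : open W1.
  apply: open_preimage_on.
  - exact: open_tangent_chart.
  - exact: (sT a 0).
  - exact: open_neq.
pose W := W0 `&` W1.
have oW : open W by exact: openI.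
have sF l : Ck_on l W (fval F a) by apply: Ck_on_subset (sW0 l) => w [].
have dF w : W w -> differentiable (fval F a) w by have [+ _] := sF 1; exact.
have Dmul v w : W w ->
    'D_v (fsquare F a) w = (2 * fval F a w) * 'D_v (fval F a) w.
  move=> Ww; have dv := derivableP (@diff_derivable _ _ _ _ _ v (dF w Ww)).
  have /@derive_val := is_derive_mulf dv dv.
  rewrite (_ : (fun x => _) = fsquare F a) => [->|]; last first.
    by apply/funext => u; rewrite /fsquare expr2.
  by rewrite -mulrDl -mulr2n mulr_natl.
have FX w : W w -> T a w = fval F a w ^+ k.
  by move=> [/WF /= Ww _]; rewrite /F /= real_rootX.
exists W; split=> //.
- by move=> l; exact: (Ck_onM oW (sF l) (sF l)).
- move=> w i Ww; rewrite (covariant_chain _ _ (fun v => Dmul v w Ww)).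
  have [_ [/= Uw Tw]] := Ww.
  have DT v : 'D_v (T a) w = (k%:R * fval F a w ^+ k.-1) * 'D_v (fval F a) w.
    have -> : 'D_v (T a) w = 'D_v (fun w => fval F a w ^+ k) w.
      apply: near_eq_derive; apply: filterS (open_nbhs_nbhs (conj oW Ww)) => u.
      exact: FX.
    rewrite (_ : (fun w => fval F a w ^+ k) = fval F a ^+ k); last first.
      by apply/funext => u; rewrite exprfctE.
    exact: (deriveX k (@diff_derivable _ _ _ _ _ v (dF w Ww))).
  have /eqP := covariant_chain gamma i DT; rewrite cT// eq_sym mulf_eq0.
  have F0 : fval F a w != 0 by exact: real_root_eq0.
  have kF : k%:R * fval F a w ^+ k.-1 != 0.
    by rewrite mulf_neq0 ?expf_neq0// pnatr_eq0 -lt0n.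
  by rewrite (negPf kF) /= => /eqP ->; rewrite mulr0.
Qed.

(** * Geodesics across charts *)

(** By the chain rule the transition map carries the velocity in chart [a] to that in chart [b], as
    [tm_compatible] requires. Continuity of [c] keeps the curve in chart [a] near [t]. *)
Lemma lift_change_chart (R : realType) (n : nat) (M : manifold R n)
    (T : tm_fun M) (a b : atlas M) (c : R -> M) (t : R) :
  tm_compatible T -> {for t, continuous c} ->
  cdom (chart_of a) (c t) -> cdom (chart_of b) (c t) ->
  differentiable (fun s => coord (chart_of a) (c s)) t ->
  T a (curve_lift c a t) = T b (curve_lift c b t).
Proof.
move=> cT ct at_ bt da; rewrite (cT a b (c t) _ at_ bt); congr (T b (_, _)).
have dtr : differentiable (transition (chart_of a) (chart_of b))
    (coord (chart_of a) (c t)).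
  by have [+ _] := @chart_compat _ _ M a b 1; apply; exists (c t).
have /@derive_val := is_derive_curve da dtr.
rewrite !derive1E => <-; apply: near_eq_derive.
have nt : nbhs t [set s | cdom (chart_of a) (c s)].
  apply: ct; apply: open_nbhs_nbhs; split=> //; exact: cdom_open.
by apply: filterS nt => s /= cs; rewrite /transition coordK.
Qed.

Lemma derive0_constant (R : realType) (J : set R) (f : R -> R) :
  is_interval J -> (forall t, J t -> is_derive t (1 : R) f 0) ->
  forall s t, J s -> J t -> f s = f t.
Proof.
move=> iJ df.
have mono s t : s <= t -> J s -> J t -> f s = f t.
  move=> st Js Jt.
  have Jr r : r \in `[s, t]%R -> J r.
    by rewrite in_itv /= => str; apply: (iJ s t).
  have [r /subset_itv_oo_cc/Jr/df //||r _] := @MVT_segment R f (fun=> 0) s t st.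
    by apply: derivable_within_continuous => r /Jr/df[].
  by rewrite mul0r => /eqP; rewrite subr_eq0 => /eqP.
by move=> s t Js Jt; case: (leP s t) => [|/ltW] st; [|apply/esym]; exact: mono.
Qed.

Lemma curve_liftE (R : realType) (n : nat) (M : manifold R n) (c : R -> M)
    (a : atlas M) :
  let xi := fun s => coord (chart_of a) (c s) in
  curve_lift c a = fun s => (xi s, 'D_1 xi s).
Proof. by apply/funext => s; rewrite /curve_lift derive1E. Qed.

Lemma smooth_curve_differentiable (R : realType) (n : nat) (M : manifold R n)
    (J : set R) (c : R -> M) (a : atlas M) (t : R) :
  let xi := fun s => coord (chart_of a) (c s) in
  smooth_on [set t | J t /\ cdom (chart_of a) (c t)] xi ->
  J t -> cdom (chart_of a) (c t) ->
  differentiable xi t /\ differentiable ('D_1 xi) t.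
Proof.
move=> xi sxi Jt ct; have [d1 /(_ 1)[d2 _]] := sxi 2.
by split; [exact: d1 | exact: d2].
Qed.

(** In this form the equation involves [gamma] alone; [F] enters only through the regularity of the
    velocities. *)
Lemma geodesicP (R : realType) (n : nat) (M : manifold R n)
    (gamma : riemannian M) (F : fundamental M) (J : set R) (c : R -> M) :
  metric_compatible gamma F ->
  is_geodesic F J c <->
  [/\ [/\ open J, is_interval J & J !=set0],
      forall t, J t -> {for t, continuous c},
      forall a : atlas M,
        smooth_on [set t | J t /\ cdom (chart_of a) (c t)]
                  (fun t => coord (chart_of a) (c t))
    & forall (a : atlas M) t, J t -> cdom (chart_of a) (c t) ->
        regular F a (curve_lift c a t) /\
        forall r,
          acceleration gamma a (fun s => coord (chart_of a) (c s)) t r = 0].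
Proof.
move=> cF; split=> -[hJ hc hs hE]; split=> // a t Jt ct.
all: have [rt] := hE a t Jt ct; rewrite curve_liftE in rt *; split=> //.
all: have [d1 d2] := smooth_curve_differentiable (hs a) Jt ct.
all: exact/(euler_lagrangeP cF rt d1 d2).
Qed.

(** With zero acceleration, [derive_lift] gives [T] zero derivative along the curve. Compatibility
    of [T] with chart changes makes this a global statement, valid for curves that leave a chart. *)
Lemma constant_along_geodesic (R : realType) (n : nat) (M : manifold R n)
    (gamma : riemannian M) (T : tm_fun M) (F : fundamental M) (J : set R)
    (c : R -> M) :
  metric_compatible gamma F -> tm_compatible T ->
  (forall a, smooth_on [set z | cimg (chart_of a) z.1] (T a)) ->
  (forall a z i, cimg (chart_of a) z.1 ->
     covariant_derivative gamma T a z i = 0) ->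
  is_geodesic F J c ->
  forall (a b : atlas M) (s t : R), J s -> J t ->
  cdom (chart_of a) (c s) -> cdom (chart_of b) (c t) ->
  T a (curve_lift c a s) = T b (curve_lift c b t).
Proof.
move=> cF compT sT cT /(geodesicP _ _ cF)[[oJ iJ _] hc hs hE].
pose ch p := projT1 (cid (@chart_cover _ _ M p)).
have chP p : cdom (chart_of (ch p)) p by rewrite /ch; case: cid.
have indep (a b : atlas M) t : J t -> cdom (chart_of a) (c t) ->
    cdom (chart_of b) (c t) -> T a (curve_lift c a t) = T b (curve_lift c b t).
  move=> Jt at_ bt; apply: lift_change_chart => //; first exact: hc.
  exact: (smooth_curve_differentiable (hs a) Jt at_).1.
(* The chosen chart varies with [t], but near each time [tau] agrees with the expression of [T] in
   one fixed chart, by [indep]. *)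
pose tau t := T (ch (c t)) (curve_lift c (ch (c t)) t).
have dtau t : J t -> is_derive t (1 : R) tau 0.
  move=> Jt; set a := ch (c t).
  have at_ : cdom (chart_of a) (c t) by exact: chP.
  apply: (@near_eq_is_derive _ _ _ (fun s => T a (curve_lift c a s))).
    have nt : nbhs t [set s | cdom (chart_of a) (c s)].
      by apply: (hc t Jt); apply: open_nbhs_nbhs; split=> //; exact: cdom_open.
    apply: filterS2 nt (open_nbhs_nbhs (conj oJ Jt)) => s cs Js.
    exact: indep.
  have [[Ux _ _] acc0] := hE a t Jt at_.
  have [d1 d2] := smooth_curve_differentiable (hs a) Jt at_.
  rewrite curve_liftE in Ux *.
  have dT : differentiable (T a) (coord (chart_of a) (c t),
      'D_1 (fun s => coord (chart_of a) (c s)) t).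
    by have [+ _] := sT a 1; apply.
  apply: is_derive_eq (derive_lift d1 d2 dT _) _; first by move=> i; exact: cT.
  by apply: big1 => r _; rewrite acc0 mul0r.
move=> a b s t Js Jt as_ bt.
rewrite (indep a (ch (c s)) s)// (indep b (ch (c t)) t)//.
exact: derive0_constant iJ dtau s t Js Jt.
Qed.

(** * Projective equivalence of the two metrics *)

Unset Implicit Arguments.

Theorem proposition21 (R : realType) (n m : nat) (M : manifold R n)
    (gamma : riemannian M) (alpha : tm_fun M)
    (hm : (0 < m)%N)
    (halpha : homogeneous_polynomial m alpha)
    (hcov : forall (a : atlas M) (x y : 'rV[R]_n) (i : 'I_n),
        cimg (chart_of a) x ->
        covariant_derivative gamma alpha a (x, y) i = 0)
    (hF : root_metric_space (m + 2)
            (fun a z => alpha a z * rquad gamma a z)) :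
  projective
    (root_fundamental (m + 2) (fun a z => alpha a z * rquad gamma a z))
    (riemannian_fundamental gamma).
Proof.
set T : tm_fun M := fun a z => alpha a z * rquad gamma a z.
have [_ [compT _] detF] := hF.
have sa a := @smooth_homogeneous _ _ _ _ _ a halpha.
have sq a := @smooth_rquad _ _ _ gamma a.
have sT a : smooth_on [set z | cimg (chart_of a) z.1] (T a).
  by move=> l; apply: Ck_onM; [exact: open_tangent_chart | exact: sa | exact: sq].
have cT a z i : cimg (chart_of a) z.1 -> covariant_derivative gamma T a z i = 0.
  case: z => x y Ux; rewrite covariantM.
  - by rewrite covariant_rquad// hcov// !mulr0 addr0.
  - by have [+ _] := sa a 1; apply.
  - by have [+ _] := sq a 1; apply.
have rT a z : regular (root_fundamental (m + 2) T) a z ->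
    T a z != 0 /\
    \det (fundamental_tensor (root_fundamental (m + 2) T) a z) != 0.
  move=> rz; have dz := detF a z rz; split=> //.
  have [Ux y0 _] := rz; apply: mulf_neq0; first exact: regular_root_neq0 rz dz.
  by rewrite gt_eqF// rmx_pos.
have compF : metric_compatible gamma (root_fundamental (m + 2) T).
  by apply: root_metric_compatible => //; rewrite addn2.
have compG := @riemannian_metric_compatible _ _ _ gamma.
(* The affine parametrizations agree, so the curve itself is the required geodesic; only regularity
   for the other metric has to be checked. *)
split=> J c gc [b [t0 [Jt0 bt0 rt0]]]; exists J, c; split=> //.
  move: gc => /(geodesicP _ _ compF)[hJ hc hs hE]; apply/(geodesicP _ _ compG).
  split=> // a t Jt ct; have [[Ux y0 _] acc0] := hE a t Jt ct; split=> //.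
  exact: riemannian_regular.
(* Constancy of [T] carries its nonvanishing, and its sign when the order is even, from the time
   [t0] to all of [J]. *)
have Tconst := constant_along_geodesic compG compT sT cT gc.
move: gc => /(geodesicP _ _ compG)[hJ hc hs hE]; apply/(geodesicP _ _ compF).
split=> // a t Jt ct; have [[Ux y0 _] acc0] := hE a t Jt ct; split=> //.
have [T0 _] := rT _ _ rt0.
have Td : odd (m + 2) \/ 0 <= T b (curve_lift c b t0).
  by have [_ _ [W [_ Wz WF _]]] := rt0; exact: WF.
have E : T b (curve_lift c b t0) = T a (curve_lift c a t).
  exact: Tconst b a t0 t Jt0 Jt bt0 ct.
rewrite E in T0 Td; exact: root_regular (sT a) Ux y0 Td T0.
Qed.
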